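(* Let $0<r\le1$, $0<\alpha\le\frac12$, $0\le\rho,\delta\le1$, and $k\in\mathbb{N}$ with $k>\frac n2$. Let $a\in S^m_{\rho,\delta,0,2k}(\mathbb{T}^n\times\mathbb{Z}^n)$. Assume $w_1=\alpha n$, $1<p_1\le2$, $q_1=(\alpha+\frac1{p_1'})^{-1}$, and $0\le w_2<2k-n$, $m<-\frac nr-w_2-2k\delta$, $1\le p_2\le\infty$, $1\le q_2\le\infty$. Then the pseudo-differential operator $T_a:B^{w_1}_{p_1,q_1}(\mathbb{T}^n)\to B^{w_2}_{p_2,q_2}(\mathbb{T}^n)$ is $r$-nuclear.
   Context: Toroidal Fourier transform: $\widehat f(\xi)=\int_{\mathbb{T}^n}e^{-i2\pi x\cdot\xi}f(x)dx$, $\xi\in\mathbb{Z}^n$; $\langle\xi\rangle=(1+|\xi|^2)^{1/2}$. For $\mu\in\mathbb{N}$, $S^m_{\rho,\delta,0,\mu}(\mathbb{T}^n\times\mathbb{Z}^n)$ is the set of functions $a(x,\xi)$, smooth in $x\in\mathbb{T}^n$ for each $\xi\in\mathbb{Z}^n$, with $|\partial_x^\beta a(x,\xi)|\le C_\beta\langle\xi\rangle^{m+\delta|\beta|}$ for all $|\beta|\le\mu$. The associated operator is $T_au(x)=\sum_{\xi\in\mathbb{Z}^n}e^{i2\pi x\cdot\xi}a(x,\xi)\widehat u(\xi)$. Periodic Besov spaces: for $w\in\mathbb{R}$, $0<p\le\infty$, $0<q<\infty$, $\|f\|_{B^w_{p,q}}=\big(\sum_{m=0}^\infty2^{mwq}\|\sum_{2^m\le|\xi|<2^{m+1}}e^{i2\pi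 x\cdot\xi}\widehat f(\xi)\|^q_{L^p(\mathbb{T}^n)}\big)^{1/q}$, and $\|f\|_{B^w_{p,\infty}}=\sup_{m\in\mathbb{N}}2^{mw}\|\sum_{2^m\le|\xi|<2^{m+1}}e^{i2\pi x\cdot\xi}\widehat f(\xi)\|_{L^p(\mathbb{T}^n)}$. $p'$ is the conjugate exponent. For Banach spaces $E,F$, $T:E\to F$ is $r$-nuclear if $Tf=\sum_ne_n'(f)y_n$ with $e'_n\in E'$, $y_n\in F$, $\sum_n\|e'_n\|^r_{E'}\|y_n\|^r_F<\infty$.
   Formalization: The displayed Besov norm omits the frequency ξ=0, so it is only a seminorm and the claim fails on constants; here the first dyadic block is taken as |ξ|<2, which includes ξ=0. *)

(* Defs.v *)
From HB Require Import structures.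
From mathcomp Require Import all_boot all_order all_algebra.
From mathcomp Require Import all_classical all_reals all_analysis.
From mathcomp Require Import complex.
Set Implicit Arguments.
Unset Strict Implicit.
Unset Printing Implicit Defensive.
Import Order.TTheory GRing.Theory Num.Theory.
Import numFieldNormedType.Exports.
Local Open Scope classical_set_scope.
Local Open Scope ring_scope.

Notation Cplx R := (complex.complex R).

Section TorusBesov.
Variable R : realType.
Variable n : nat.

Definition cRe (z : Cplx R) : R := complex.Re z.
Definition cIm (z : Cplx R) : R := complex.Im z.
Definition cmk (a b : R) : Cplx R := complex.Complex a b.
Definition cabs (z : Cplx R) : R := Num.sqrt (cRe z ^+ 2 + cIm z ^+ 2).
Definition e2pi (t : R) : Cplx R := cmk (cos (2 * pi * t)) (sin (2 * pi * t)).

(* ---------- points of R^n (torus = 1-periodic functions) and Z^n ---------- *)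
Definition unitv (j : 'I_n) : 'rV[R]_n := delta_mx 0 j.
Definition dotp (x : 'rV[R]_n) (xi : 'rV[int]_n) : R :=
  \sum_(i < n) x 0 i * (xi 0 i)%:~R.
Definition nrm2 (xi : 'rV[int]_n) : int := \sum_(i < n) xi 0 i ^+ 2.
Definition jbr (xi : 'rV[int]_n) : R := Num.sqrt (1 + (nrm2 xi)%:~R).

Definition upd (x : 'rV[R]_n) (j : 'I_n) (t : R) : 'rV[R]_n :=
  x + (t - x 0 j) *: unitv j.
Fixpoint iint (s : seq 'I_n) (g : 'rV[R]_n -> R) : 'rV[R]_n -> R :=
  match s with
  | [::] => g
  | j :: s' => fun x => Rintegral (@lebesgue_measure R)
                          [set t : R | 0 <= t <= 1] (fun t => iint s' g (upd x j t))
  end.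
Definition torus_int (g : 'rV[R]_n -> R) : R := iint (enum 'I_n) g 0.
Definition ctorus_int (g : 'rV[R]_n -> Cplx R) : Cplx R :=
  cmk (torus_int (fun x => cRe (g x))) (torus_int (fun x => cIm (g x))).

Definition fourier (f : 'rV[R]_n -> Cplx R) (xi : 'rV[int]_n) : Cplx R :=
  ctorus_int (fun x => e2pi (- dotp x xi) * f x).

Definition cube : set 'rV[R]_n := [set x | forall i, 0 <= x 0 i <= 1].

(* L^p(T^n) norm, p in [1, +oo]; used only on trigonometric polynomials *)
Definition Lpnorm (p : \bar R) (f : 'rV[R]_n -> Cplx R) : \bar R :=
  match p with
  | +oo%E => ereal_sup [set (cabs (f x))%:E | x in cube]
  | (s%:E)%E => (powR (torus_int (fun x => powR (cabs (f x)) s)) s^-1)%:E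
  | -oo%E => 0%E
  end.

Definition freq_of (N : nat) (k : {ffun 'I_n -> 'I_(2 * N).+1}) : 'rV[int]_n :=
  \row_i ((k i : nat)%:Z - N%:Z).
Definition inblock (m : nat) (xi : 'rV[int]_n) : bool :=
  if m == 0%N then nrm2 xi < 4
  else ((4 ^ m)%:Z <= nrm2 xi) && (nrm2 xi < (4 ^ m.+1)%:Z).
Definition block (m : nat) (c : 'rV[int]_n -> Cplx R) (x : 'rV[R]_n) : Cplx R :=
  \sum_(k : {ffun 'I_n -> 'I_(2 * 2 ^ m.+1).+1} | inblock m (freq_of k))
     e2pi (dotp x (freq_of k)) * c (freq_of k).

(* ---------- periodic Besov norm, on Fourier coefficient sequences ---------- *)
Definition besov_norm (w : R) (p q : \bar R) (c : 'rV[int]_n -> Cplx R) : \bar R :=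
  let t := fun m : nat => ((powR 2 (m%:R * w))%:E * Lpnorm p (block m c))%E in
  match q with
  | +oo%E => ereal_sup (range t)
  | (s%:E)%E => poweR (\sum_(0 <= m <oo) poweR (t m) s)%E s^-1
  | -oo%E => 0%E
  end.
Definition in_besov (w : R) (p q : \bar R) (c : 'rV[int]_n -> Cplx R) : Prop :=
  (besov_norm w p q c < +oo)%E.

Definition is_dual_elt (w : R) (p q : \bar R) (e : ('rV[int]_n -> Cplx R) -> Cplx R) :=
  (forall (c d : 'rV[int]_n -> Cplx R) (l : Cplx R),
      in_besov w p q c -> in_besov w p q d ->
      e (fun xi => l * c xi + d xi) = l * e c + e d) /\
  exists M : R, forall c, in_besov w p q c ->
      ((cabs (e c))%:E <= M%:E * besov_norm w p q c)%E.
Definition dual_norm (w : R) (p q : \bar R) (e : ('rV[int]_n -> Cplx R) -> Cplx R) : \bar R :=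
  ereal_sup [set (cabs (e c))%:E |
             c in [set c | in_besov w p q c /\ (besov_norm w p q c <= 1)%E]].

Definition r_nuclear (r : R)
    (T : ('rV[int]_n -> Cplx R) -> ('rV[int]_n -> Cplx R))
    (wE : R) (pE qE : \bar R) (wF : R) (pF qF : \bar R) : Prop :=
  exists (e : nat -> ('rV[int]_n -> Cplx R) -> Cplx R) (y : nat -> 'rV[int]_n -> Cplx R),
    (forall k, is_dual_elt wE pE qE (e k)) /\
    (forall k, in_besov wF pF qF (y k)) /\
    (\sum_(0 <= k <oo) poweR (dual_norm wE pE qE (e k) * besov_norm wF pF qF (y k)) r
       < +oo)%E /\
    (forall c, in_besov wE pE qE c ->
       (fun N : nat => besov_norm wF pF qF
          (fun xi => T c xi - \sum_(k < N) e k c * y k xi)) @ \oo --> 0%E).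

Definition pd (j : 'I_n) (g : 'rV[R]_n -> R) : 'rV[R]_n -> R :=
  fun x => derive g x (unitv j).
Definition pds (s : seq 'I_n) (g : 'rV[R]_n -> R) : 'rV[R]_n -> R :=
  foldr pd g s.
Definition smooth (g : 'rV[R]_n -> R) : Prop :=
  forall s : seq 'I_n, continuous (pds s g) /\
    forall (j : 'I_n) (x : 'rV[R]_n), derivable (pds s g) x (unitv j).
Definition pdC (s : seq 'I_n) (f : 'rV[R]_n -> Cplx R) : 'rV[R]_n -> Cplx R :=
  fun x => cmk (pds s (fun y => cRe (f y)) x) (pds s (fun y => cIm (f y)) x).
Definition beta_seq (beta : 'I_n -> nat) : seq 'I_n :=
  flatten [seq nseq (beta j) j | j <- enum 'I_n].
Definition mlen (beta : 'I_n -> nat) : nat := \sum_(j < n) beta j.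

Definition symbol_class (m rho delta : R) (mu : nat)
    (a : 'rV[R]_n -> 'rV[int]_n -> Cplx R) : Prop :=
  (forall xi, smooth (fun x => cRe (a x xi)) /\ smooth (fun x => cIm (a x xi))) /\
  (forall xi x (j : 'I_n), a (x + unitv j) xi = a x xi) /\
  (forall beta : 'I_n -> nat, (mlen beta <= mu)%N ->
     exists C : R, forall x xi,
       cabs (pdC (beta_seq beta) (fun y => a y xi) x)
         <= C * powR (jbr xi) (m + delta * (mlen beta)%:R)).

Definition Ta_partial (a : 'rV[R]_n -> 'rV[int]_n -> Cplx R)
    (c : 'rV[int]_n -> Cplx R) (N : nat) (x : 'rV[R]_n) : Cplx R :=
  \sum_(k : {ffun 'I_n -> 'I_(2 * N).+1})
     e2pi (dotp x (freq_of k)) * a x (freq_of k) * c (freq_of k).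
Definition Ta_fun (a : 'rV[R]_n -> 'rV[int]_n -> Cplx R)
    (c : 'rV[int]_n -> Cplx R) (x : 'rV[R]_n) : Cplx R :=
  cmk (limn (fun N => cRe (Ta_partial a c N x)))
      (limn (fun N => cIm (Ta_partial a c N x))).
(* T_a acting on Fourier coefficients: u^ |-> (T_a u)^ *)
Definition Ta (a : 'rV[R]_n -> 'rV[int]_n -> Cplx R)
    (c : 'rV[int]_n -> Cplx R) : 'rV[int]_n -> Cplx R :=
  fourier (Ta_fun a c).

End TorusBesov.

(* Main.v *)
(** Expand T_a u = sum_xi u^(xi) y_xi with y_xi = e2pi(x . xi) a(x, xi).
    The functional u |-> u^(xi) is bounded on the source space, because |u^(xi)|
    is at most a constant times the L^p1 norm of the dyadic block containing xi.
    The coefficient of y_xi at eta is a^(eta - xi, xi), which 2k derivatives of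
    the symbol bound by C <xi>^(m + 2k delta) <eta - xi>^(-2k); by Peetre's
    inequality and w2 - 2k < -n, the weighted l^1 norm of these coefficients,
    which dominates every target norm, is at most K <xi>^(-s) with
    s = -(m + 2k delta + w2). Since s r > n, the r-th powers are summable over
    Z^n. *)
Require Import Defs.
From HB Require Import structures.
From mathcomp Require Import all_boot all_order all_algebra.
From mathcomp Require Import all_classical all_reals all_analysis.
From mathcomp Require Import complex.
From mathcomp Require Import ring lra zify.
Set Implicit Arguments.
Unset Strict Implicit.
Unset Printing Implicit Defensive.
Import Order.TTheory GRing.Theory Num.Theory.
Import numFieldNormedType.Exports.
Local Open Scope classical_set_scope.
Local Open Scope ring_scope.

(** The torus integral is an iterated one-dimensional integral, and the Fourier analysis rests on
    one property of it: invariance under translation along a coordinate. Shifting by half a period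
    gives the orthogonality of the exponentials and, through iterated differences, the decay of the
    symbol's coefficients, without integration by parts or a change in the order of integration.
    Three orders of summation over the lattice meet: boxes in [Ta_partial], dyadic blocks in the
    Besov norm, and the enumeration of the nuclear series. Estimates are therefore stated as one
    bound on all finite sums ([sum_bounded]), which does not see the order. Since [Ta] takes a
    pointwise limit and then Fourier coefficients, the expansion itself has to be justified. The
    coefficients of an element of the source space are bounded and [s > n], so the series converges
    uniformly in [x]; the weighted estimates then pass from finite sums to the limit. *)

(** * Integration over the unit interval and periodicity *)

Section UnitInterval.
Context {R : realType}.
Implicit Types f g : R -> R.

Local Notation unit_int f := (Rintegral (@lebesgue_measure R)
  [set t : R | 0 <= t <= 1] f).

Lemma unit_intervalE : [set t : R | 0 <= t <= 1] = `[0, 1]%classic.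
Proof. by apply/seteqP; split => t /=; rewrite in_itv. Qed.

Lemma continuous_integrable_itv f (a b : R) : continuous f ->
  (@lebesgue_measure R).-integrable `[a, b]%classic (EFin \o f).
Proof.
move=> cf; apply: continuous_compact_integrable; first exact: segment_compact.
exact: continuous_subspaceT.
Qed.

Lemma continuous_integrable_unit f : continuous f ->
  (@lebesgue_measure R).-integrable [set t : R | 0 <= t <= 1] (EFin \o f).
Proof. by rewrite unit_intervalE; exact: continuous_integrable_itv. Qed.

Lemma measurable_unit_interval :
  measurable ([set t : R | 0 <= t <= 1] : set (measurableTypeR R)).
Proof. by rewrite unit_intervalE; exact: measurable_itv. Qed.

Lemma unit_intD f g : continuous f -> continuous g ->
  unit_int (fun t => f t + g t) = unit_int f + unit_int g.
Proof.
move=> cf cg; rewrite RintegralD//; first exact: measurable_unit_interval.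
- exact: continuous_integrable_unit.
- exact: continuous_integrable_unit.
Qed.

Lemma unit_intZ (c : R) f : continuous f -> unit_int (fun t => c * f t) = c * unit_int f.
Proof.
move=> cf; rewrite RintegralZl//; first exact: measurable_unit_interval.
exact: continuous_integrable_unit.
Qed.

Lemma unit_int_cst (c : R) : unit_int (fun=> c) = c.
Proof.
rewrite Rintegral_cst; last exact: measurable_unit_interval.
rewrite unit_intervalE (_ : fine _ = 1) ?mulr1//.
have := @lebesgue_measure_itv R `[0, 1]%R; rewrite /= lte_fin ltr01 oppr0 adde0.
by move=> ->.
Qed.

Lemma unit_int_le f g : continuous f -> continuous g ->
  (forall t, 0 <= t <= 1 -> f t <= g t) -> unit_int f <= unit_int g.
Proof.
move=> cf cg fg; apply: le_Rintegral => //; first exact: measurable_unit_interval.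
- exact: continuous_integrable_unit.
- exact: continuous_integrable_unit.
Qed.

(** The indefinite integral based at [- A]. A bounded window suffices, because a translation by
    [tau] only involves points within [|tau| + 1] of the origin. *)
Lemma antiderivative f (A : R) : continuous f ->
  exists F : R -> R, forall x, - A < x < A -> is_derive x 1 F (f x).
Proof.
move=> cf; exists (fun x => \int[lebesgue_measure]_(t in `[- A, x]) f t).
move=> x /andP[Ax xA].
have [|d e] := @continuous_FTC1_closed R f (- A) x A xA _ Ax (cf x).
  exact: continuous_integrable_itv.
by apply: DeriveDef; [exact: d|rewrite -derive1E; exact: e].
Qed.

Lemma is_derive_shift (F : R -> R) (x c d : R) :
  is_derive (x + c) 1 F d -> is_derive x 1 (fun t => F (t + c)) d.
Proof.
move=> H; have h : is_derive x 1 (fun t : R => t + c) 1.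
  by rewrite -[X in is_derive _ _ _ X]addr0; apply: is_deriveD.
by have := @is_derive1_comp R F (fun t => t + c) x d 1 H h; rewrite mulr1.
Qed.

Lemma unit_int_antiderivative (f F : R -> R) (c : R) : continuous f ->
  (forall x, c <= x <= 1 + c -> is_derive x 1 F (f x)) ->
  unit_int (fun t => f (t + c)) = F (1 + c) - F c.
Proof.
move=> cf dF.
have D (x : R) : 0 <= x <= 1 -> is_derive x 1 (fun t => F (t + c)) (f (x + c)).
  by move=> x01; apply: is_derive_shift; apply: dF; lra.
have C (x : R) : 0 <= x <= 1 -> {for x, continuous (fun t => F (t + c))}.
  move=> /D [dx _]; apply: differentiable_continuous.
  exact/derivable1_diffP.
rewrite unit_intervalE /Rintegral.
rewrite (@continuous_FTC2 _ (fun t => f (t + c)) (fun t => F (t + c)))//=.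
- by rewrite add0r.
- apply: continuous_subspaceT => x.
  by apply: continuous_comp; [apply: cvgD; [exact: cvg_id|exact: cvg_cst]|exact: cf].
- split.
  + by move=> x; rewrite in_itv/= => x01; case: (D x); [lra|].
  + by apply: cvg_at_right_filter; apply: C; lra.
  + by apply: cvg_at_left_filter; apply: C; lra.
- move=> x; rewrite in_itv/= => x01; rewrite derive1E.
  by apply: derive_val; apply: D; lra.
Qed.

(** By periodicity [F (t + 1) - F t] has derivative [f (t + 1) - f t = 0], so the integral over
    [[c, c + 1]] does not depend on [c]. The radius [|tau| + 3] leaves room for the points
    [t + 1]. *)
Lemma unit_int_translate f (tau : R) : continuous f -> (forall t, f (t + 1) = f t) ->
  unit_int (fun t => f (t + tau)) = unit_int f.
Proof.
move=> cf per; have [F dF] := antiderivative (`|tau| + 3) cf.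
have tb := ler_norm tau; have tb' := ler_norm (- tau).
rewrite normrN in tb'.
have dG x : - `|tau| <= x <= `|tau| ->
    is_derive x 1 (fun t => F (t + 1) - F t) 0.
  move=> xt; rewrite -(subrr (f x)) -{1}per.
  apply: is_deriveB; last by apply: dF; lra.
  by apply: is_derive_shift; apply: dF; lra.
have Gc (x y : R) : - `|tau| <= x -> x <= y -> y <= `|tau| ->
    F (y + 1) - F y = F (x + 1) - F x.
  move=> tx xy yt.
  have [||c _] := @MVT_segment R (fun t => F (t + 1) - F t) (fun=> 0) x y xy.
  - by move=> z; rewrite in_itv/= => /andP[? ?]; apply: dG; lra.
  - apply: continuous_in_subspaceT => z; rewrite inE/= in_itv/= => /andP[? ?].
    by apply: differentiable_continuous; apply/derivable1_diffP; case: (dG z) => //; lra.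
  - by rewrite mul0r => /eqP; rewrite subr_eq0 => /eqP.
have IF c : - `|tau| <= c <= `|tau| ->
    unit_int (fun t => f (t + c)) = F (c + 1) - F c.
  move=> ct; rewrite [c + 1]addrC; apply: unit_int_antiderivative => // x ?.
  by apply: dF; lra.
rewrite IF; last by apply/andP; split; lra.
rewrite -[RHS](_ : unit_int (fun t => f (t + 0)) = _); last first.
  by congr Rintegral; apply/funext => t; rewrite addr0.
rewrite IF; last by apply/andP; split; lra.
have [t0|t0] := leP 0 tau; first by apply: Gc; lra.
by apply/esym/Gc; lra.
Qed.

End UnitInterval.

(** * Iterated integrals over the torus *)

Section IteratedIntegral.
Context {R : realType} {n : nat}.
Implicit Types (x : 'rV[R]_n) (f g : 'rV[R]_n -> R) (i j : 'I_n).

Lemma updE x j (t : R) l : upd x j t 0 l = if l == j then t else x 0 l.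
Proof.
rewrite /upd /unitv !mxE eqxx/=; case: eqVneq => [->|_].
  by rewrite mulr1 addrC subrK.
by rewrite mulr0 addr0.
Qed.

Lemma shiftE x i (tau : R) l :
  (x + tau *: unitv R i) 0 l = x 0 l + (if l == i then tau else 0).
Proof. by rewrite /unitv !mxE eqxx/=; case: eqVneq; rewrite ?mulr1 ?mulr0. Qed.

Lemma upd_shift x i j (tau t : R) : i != j ->
  upd (x + tau *: unitv R i) j t = upd x j t + tau *: unitv R i.
Proof.
move=> ij; apply/rowP => l; rewrite (updE _ j) (shiftE (upd x j t)) (shiftE x) (updE x).
by case: (eqVneq l j) => [->|//]; rewrite eq_sym (negbTE ij) addr0.
Qed.

Lemma upd_addr x i (tau t : R) :
  upd x i (t + tau) = upd x i t + tau *: unitv R i.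
Proof.
apply/rowP => l; rewrite (updE x i (t + tau)) (shiftE (upd x i t)) (updE x i t).
by case: (eqVneq l i); rewrite ?addr0.
Qed.

Lemma upd_continuous j : continuous (fun p : R * 'rV[R]_n => upd p.2 j p.1).
Proof.
move=> p; rewrite /upd; apply: cvgD; first exact: cvg_snd.
apply: cvgZl; apply: cvgB; first exact: cvg_fst.
apply: (@continuous_comp _ _ _ snd (fun x : 'rV[R]_n => x 0 j)).
  exact: cvg_snd.
exact: coord_continuous.
Qed.

Lemma upd_continuousr x j : continuous (upd x j : R -> 'rV[R]_n).
Proof.
move=> t; rewrite /upd; apply: cvgD; first exact: cvg_cst.
by apply: cvgZl; apply: cvgB; [exact: cvg_id|exact: cvg_cst].
Qed.

(** Joint continuity in [(t, x)] and compactness of [[0, 1]] make the integrands uniformly close for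
    [x] near [x0]. This keeps every inner integral continuous, hence integrable at the next
    level. *)
Lemma integral_upd_continuous g j : continuous g ->
  continuous (fun x => Rintegral (@lebesgue_measure R)
    [set t : R | 0 <= t <= 1] (fun t => g (upd x j t))).
Proof.
move=> cg x0; apply/(@cvgrPdist_le _ _ _ (nbhs x0) (nbhs_filter x0)) => e e0.
have cgu x : continuous (fun t : R => g (upd x j t)).
  move=> t; apply: continuous_comp; first exact: upd_continuousr.
  exact: cg.
have /compact_near_coveringP cov := @segment_compact R 0 1.
have H : \forall x \near x0, `[0, 1]%classic `<=`
    [set t : R | `|g (upd x0 j t) - g (upd x j t)| < e].
  apply: (cov _ (nbhs x0) (fun x t => `|g (upd x0 j t) - g (upd x j t)| < e)
    (nbhs_filter x0)) => t _.
  have C : {for (t, x0), continuous (fun p : R * 'rV[R]_n =>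
      g (upd x0 j p.1) - g (upd p.2 j p.1))}.
    apply: cvgB; apply: continuous_comp; try exact: cg.
      apply: (@continuous_comp _ _ _ fst (upd x0 j)); first exact: cvg_fst.
      exact: upd_continuousr.
    exact: upd_continuous.
  move/(@cvgrPdist_lt _ _ _ _ (nbhs_filter _)): C => /(_ _ e0).
  by apply: filterS => -[t' x'] /=; rewrite subrr sub0r normrN.
near=> x.
have /= Hx : `[0, 1]%classic `<=` [set t : R | `|g (upd x0 j t) - g (upd x j t)| < e].
  by near: x.
have cst : continuous (fun _ : R => e) by exact: cst_continuous.
have B (y z : 'rV[R]_n) :
  (forall t : R, 0 <= t <= 1 -> g (upd y j t) <= e + g (upd z j t)) ->
  Rintegral (@lebesgue_measure R) [set t : R | 0 <= t <= 1]
    (fun t => g (upd y j t)) <= e +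
  Rintegral (@lebesgue_measure R) [set t : R | 0 <= t <= 1]
    (fun t => g (upd z j t)).
  move=> yz; rewrite -[X in _ <= X + _](@unit_int_cst R) -unit_intD//.
  apply: unit_int_le => // t; apply: cvgD; first exact: cvg_cst.
  exact: cgu.
rewrite ler_norml; apply/andP; split.
  rewrite lerNl opprB lerBlDr; apply: B => t t01.
  have := Hx t; rewrite /= in_itv/= => /(_ t01); rewrite ltr_norml; lra.
rewrite lerBlDr; apply: B => t t01.
have := Hx t; rewrite /= in_itv/= => /(_ t01); rewrite ltr_norml; lra.
Unshelve. all: by end_near. Qed.

Lemma iint_continuous s g : continuous g -> continuous (iint s g).
Proof.
by move=> cg; elim: s => [//|j s IH] /=; exact: integral_upd_continuous.
Qed.

Lemma iint_upd_continuous s g j x : continuous g ->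
  continuous (fun t : R => iint s g (upd x j t)).
Proof.
move=> cg t; apply: continuous_comp; first exact: upd_continuousr.
exact: iint_continuous.
Qed.

Lemma iintD s f g x : continuous f -> continuous g ->
  iint s (fun y => f y + g y) x = iint s f x + iint s g x.
Proof.
move=> cf cg; elim: s x => [//|j s IH] x /=.
by under eq_Rintegral do rewrite IH; rewrite unit_intD//; exact: iint_upd_continuous.
Qed.

Lemma iintZ s (c : R) f x : continuous f ->
  iint s (fun y => c * f y) x = c * iint s f x.
Proof.
move=> cf; elim: s x => [//|j s IH] x /=.
by under eq_Rintegral do rewrite IH; rewrite unit_intZ//; exact: iint_upd_continuous.
Qed.

Lemma iint_cst s (c : R) x : iint s (fun=> c) x = c.
Proof.
elim: s x => [//|j s IH] x /=.
by under eq_Rintegral do rewrite IH; rewrite unit_int_cst.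
Qed.

Lemma iint_le s f g x : continuous f -> continuous g ->
  (forall y, f y <= g y) -> iint s f x <= iint s g x.
Proof.
move=> cf cg fg; elim: s x => [//|j s IH] x /=.
by apply: unit_int_le => //; exact: iint_upd_continuous.
Qed.

Lemma iint_shift s i (tau : R) g x : i \notin s ->
  iint s (fun y => g (y + tau *: unitv R i)) x = iint s g (x + tau *: unitv R i).
Proof.
elim: s x => [//|j s IH] x /=; rewrite inE negb_or => /andP[ij iNs].
by apply: eq_Rintegral => t _; rewrite IH// upd_shift.
Qed.

Lemma iint_cat s1 s2 g : iint (s1 ++ s2) g = iint s1 (iint s2 g).
Proof. by elim: s1 => [//|j s1 IH] /=; rewrite IH. Qed.

Lemma continuous_shift g (v : 'rV[R]_n) : continuous g ->
  continuous (fun x => g (x + v)).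
Proof.
move=> cg x; apply: (@continuous_comp _ _ _ (fun x => x + v) g).
  apply: (@continuousD _ _ _ (fun x : 'rV[R]_n => x) (fun=> v)).
    by move=> A.
  exact: cst_continuous.
exact: cg.
Qed.

(** Split the coordinates as [s1 ++ i :: s2]. The shift passes through the integrals over [s2],
    which do not involve [i], and is absorbed by the periodic integral in [i]; those over [s1] are
    untouched, so no Fubini argument is needed. *)
Lemma torus_int_translate i (tau : R) g : continuous g ->
  (forall x, g (x + unitv R i) = g x) ->
  torus_int (fun x => g (x + tau *: unitv R i)) = torus_int g.
Proof.
move=> cg per; rewrite /torus_int.
have /path.splitPr : i \in enum 'I_n by rewrite mem_enum.
have : uniq (enum 'I_n) by exact: enum_uniq.
move=> + H; case: H => s1 s2; rewrite cat_uniq => /and3P[_ _ /= /andP[iNs2 _]].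
rewrite !iint_cat; congr (iint s1 _ 0); apply/funext => x /=.
under eq_Rintegral do rewrite iint_shift// -upd_addr.
apply: (@unit_int_translate R (fun t => iint s2 g (upd x i t)) tau).
  exact: iint_upd_continuous.
move=> t; rewrite upd_addr -iint_shift//; congr (iint s2 _ _).
by apply/funext => y; rewrite scale1r per.
Qed.

Lemma torus_intD f g : continuous f -> continuous g ->
  torus_int (fun x => f x + g x) = torus_int f + torus_int g.
Proof. exact: iintD. Qed.

Lemma torus_intZ (c : R) f : continuous f ->
  torus_int (fun x => c * f x) = c * torus_int f.
Proof. exact: iintZ. Qed.

Lemma torus_int_cst (c : R) : torus_int (fun _ : 'rV[R]_n => c) = c.
Proof. exact: iint_cst. Qed.

Lemma torus_int_le f g : continuous f -> continuous g ->
  (forall x, f x <= g x) -> torus_int f <= torus_int g.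
Proof. exact: iint_le. Qed.

Lemma torus_int_norm_le f (B : R) : continuous f ->
  (forall x, `|f x| <= B) -> `|torus_int f| <= B.
Proof.
move=> cf fB; have cB (b : R) : continuous (fun _ : 'rV[R]_n => b).
  by exact: cst_continuous.
rewrite ler_norml -(torus_int_cst (- B)) -{2}(torus_int_cst B).
by rewrite !torus_int_le// => [x|x]; have := fB x; rewrite ler_norml => /andP[].
Qed.

End IteratedIntegral.

(** * Modulus and exponentials on the complex numbers *)

Section ComplexValues.
Context {R : realType}.
Implicit Types z w : Cplx R.

Lemma cReD z w : cRe (z + w) = cRe z + cRe w. Proof. by case: z w => ? ? []. Qed.
Lemma cImD z w : cIm (z + w) = cIm z + cIm w. Proof. by case: z w => ? ? []. Qed.
Lemma cReN z : cRe (- z) = - cRe z. Proof. by case: z. Qed.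
Lemma cImN z : cIm (- z) = - cIm z. Proof. by case: z. Qed.
Lemma cReM z w : cRe (z * w) = cRe z * cRe w - cIm z * cIm w.
Proof. by case: z w => ? ? []. Qed.
Lemma cImM z w : cIm (z * w) = cRe z * cIm w + cIm z * cRe w.
Proof. by case: z w => ? ? []. Qed.

Lemma cplx_eq z w : cRe z = cRe w -> cIm z = cIm w -> z = w.
Proof. by case: z w => a b [c d] /= -> ->. Qed.

Lemma cabsE z : cabs z = Normc.normc z.
Proof. by case: z. Qed.

Lemma cabs0 : cabs (0 : Cplx R) = 0.
Proof. by rewrite cabsE; exact: Normc.normc0. Qed.

Lemma cabs1 : cabs (1 : Cplx R) = 1.
Proof. by rewrite cabsE; exact: Normc.normc1. Qed.

Lemma cabsM z w : cabs (z * w) = cabs z * cabs w.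
Proof. by rewrite !cabsE Normc.normcM. Qed.

Lemma cabsD z w : cabs (z + w) <= cabs z + cabs w.
Proof. by rewrite !cabsE le_normcD. Qed.

Lemma cabsN z : cabs (- z) = cabs z.
Proof. by rewrite !cabsE normcN. Qed.

Lemma cabs_ge0 z : 0 <= cabs z.
Proof. exact: sqrtr_ge0. Qed.

Lemma cabs_sum (I : Type) (s : seq I) (P : pred I) (F : I -> Cplx R) :
  cabs (\sum_(i <- s | P i) F i) <= \sum_(i <- s | P i) cabs (F i).
Proof.
elim/big_ind2 : _ => [|z x w y zx wy|//]; first by rewrite cabs0.
by rewrite (le_trans (cabsD _ _))// lerD.
Qed.

Lemma cabsX z N : cabs (z ^+ N) = cabs z ^+ N.
Proof. by elim: N => [|N IH]; rewrite ?expr0 ?cabs1// !exprS cabsM IH. Qed.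

Lemma cRe_le z : `|cRe z| <= cabs z.
Proof. by rewrite /cabs -sqrtr_sqr ler_wsqrtr// lerDl sqr_ge0. Qed.

Lemma cIm_le z : `|cIm z| <= cabs z.
Proof. by rewrite /cabs -sqrtr_sqr ler_wsqrtr// lerDr sqr_ge0. Qed.

Lemma cabs_le_ReIm z : cabs z <= `|cRe z| + `|cIm z|.
Proof.
have h : 0 <= `|cRe z| + `|cIm z| by rewrite addr_ge0.
rewrite -(ger0_norm h) -sqrtr_sqr ler_wsqrtr// sqrrD !real_normK ?num_real// addrAC lerDl.
by rewrite mulrn_wge0// mulr_ge0.
Qed.

Lemma cabs_e2pi (t : R) : cabs (e2pi t) = 1.
Proof. by rewrite /cabs /e2pi /= cos2Dsin2 sqrtr1. Qed.

Lemma e2piD (s t : R) : e2pi (s + t) = e2pi s * e2pi t.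
Proof.
apply: cplx_eq; rewrite ?cReM ?cImM /e2pi /= mulrDr ?cosD ?sinD//.
by rewrite addrC.
Qed.

Lemma e2pi0 : e2pi (0 : R) = 1.
Proof. by apply: cplx_eq; rewrite /e2pi /= mulr0 ?cos0 ?sin0. Qed.

Lemma e2piV2 : e2pi (2^-1 : R) = -1.
Proof.
have -> : e2pi (2^-1 : R) = cmk (cos pi) (sin pi).
  by rewrite /e2pi; congr cmk; congr (_ _); field.
by apply: cplx_eq; rewrite /= ?cospi ?sinpi// oppr0.
Qed.

Lemma e2pi1 : e2pi (1 : R) = 1.
Proof.
by rewrite (_ : 1 = 2^-1 + 2^-1); [rewrite e2piD e2piV2 mulrNN mulr1|lra].
Qed.

Lemma e2pi_nat (N : nat) : e2pi (N%:R : R) = 1.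
Proof. by elim: N => [|N IH]; rewrite ?e2pi0// -natr1 e2piD IH e2pi1 mulr1. Qed.

Lemma e2pi_int (N : int) : e2pi (N%:~R : R) = 1.
Proof.
case: N => N; first exact: e2pi_nat.
rewrite NegzE mulrNz; have := e2piD (- N.+1%:R : R) N.+1%:R.
by rewrite addNr e2pi0 e2pi_nat mulr1 => <-.
Qed.

End ComplexValues.

(** * Fourier coefficients of continuous functions on the torus *)

Section FourierCoefficients.
Context {R : realType} {n : nat}.
Implicit Types (x : 'rV[R]_n) (xi eta zeta : 'rV[int]_n) (i j : 'I_n).
Implicit Types (f g : 'rV[R]_n -> Cplx R).

Definition ccontinuous f :=
  continuous (fun x => cRe (f x)) /\ continuous (fun x => cIm (f x)).

Lemma ccontinuous_cst (z : Cplx R) : ccontinuous (fun=> z).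
Proof. by split; exact: cst_continuous. Qed.

Lemma ccontinuousD f g : ccontinuous f -> ccontinuous g ->
  ccontinuous (fun x => f x + g x).
Proof.
move=> [f1 f2] [g1 g2]; split.
  under eq_fun do rewrite cReD.
  by move=> x; apply: continuousD; [exact: f1|exact: g1].
under eq_fun do rewrite cImD.
by move=> x; apply: continuousD; [exact: f2|exact: g2].
Qed.

Lemma ccontinuousN f : ccontinuous f -> ccontinuous (fun x => - f x).
Proof.
move=> [f1 f2]; split.
  by under eq_fun do rewrite cReN; move=> x; apply: continuousN; exact: f1.
by under eq_fun do rewrite cImN; move=> x; apply: continuousN; exact: f2.
Qed.

Lemma ccontinuousM f g : ccontinuous f -> ccontinuous g ->
  ccontinuous (fun x => f x * g x).
Proof.
move=> [f1 f2] [g1 g2]; split.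
  under eq_fun do rewrite cReM.
  by move=> x; apply: (continuousB (continuousM (f1 x) (g1 x))
    (continuousM (f2 x) (g2 x))).
under eq_fun do rewrite cImM.
by move=> x; apply: (continuousD (continuousM (f1 x) (g2 x))
  (continuousM (f2 x) (g1 x))).
Qed.

Lemma ccontinuous_sum (I : Type) (s : seq I) (P : pred I)
    (F : I -> 'rV[R]_n -> Cplx R) : (forall k, ccontinuous (F k)) ->
  ccontinuous (fun x => \sum_(k <- s | P k) F k x).
Proof.
move=> cF; elim: s => [|k s IH].
  by under eq_fun do rewrite big_nil; exact: ccontinuous_cst.
under eq_fun do rewrite big_cons.
by case: (P k) => //; exact: ccontinuousD.
Qed.

Lemma ccontinuous_shift f (v : 'rV[R]_n) : ccontinuous f ->
  ccontinuous (fun x => f (x + v)).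
Proof.
by move=> [f1 f2]; split; [exact: (continuous_shift f1)|exact: (continuous_shift f2)].
Qed.

Lemma continuous_cabs f : ccontinuous f -> continuous (fun x => cabs (f x)).
Proof.
move=> [f1 f2] x; rewrite /cabs.
apply: (@continuous_comp _ _ _ (fun x => cRe (f x) ^+ 2 + cIm (f x) ^+ 2) Num.sqrt).
  exact: (continuousD (continuousM (f1 x) (f1 x)) (continuousM (f2 x) (f2 x))).
exact: sqrt_continuous.
Qed.

Lemma dotp_continuous xi : continuous (fun x => dotp x xi).
Proof.
rewrite /dotp; elim: (index_enum _) => [|i s IH] x.
  by under eq_fun do rewrite big_nil; exact: cst_continuous.
under eq_fun do rewrite big_cons.
apply: (@continuousD _ _ _ (fun x : 'rV[R]_n => x 0 i * (xi 0 i)%:~R)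
  (fun x => \sum_(j <- s) x 0 j * (xi 0 j)%:~R)); last exact: IH.
apply: (@continuousM _ _ (fun x : 'rV[R]_n => x 0 i) (fun=> (xi 0 i)%:~R)).
  exact: coord_continuous.
exact: cst_continuous.
Qed.

Lemma ccontinuous_e2pi xi : ccontinuous (fun x => e2pi (dotp x xi)).
Proof.
have c x : {for x, continuous (fun x => 2 * pi * dotp x xi)}.
  apply: (@continuousM _ _ (fun=> 2 * pi) (fun x => dotp x xi)).
    exact: cst_continuous.
  exact: dotp_continuous.
split=> x; rewrite /e2pi /=.
  by apply: (@continuous_comp _ _ _ (fun x => 2 * pi * dotp x xi) cos);
    [exact: c|exact: continuous_cos].
by apply: (@continuous_comp _ _ _ (fun x => 2 * pi * dotp x xi) sin);
  [exact: c|exact: continuous_sin].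
Qed.

Lemma dotpN x xi : - dotp x xi = dotp x (- xi).
Proof. by rewrite /dotp -sumrN; apply: eq_bigr => i _; rewrite mxE mulrNz mulrN. Qed.

Lemma dotpD x xi eta : dotp x (xi + eta) = dotp x xi + dotp x eta.
Proof.
by rewrite /dotp -big_split; apply: eq_bigr => i _; rewrite mxE mulrzDr mulrDr.
Qed.

Lemma dotp_shift x i (tau : R) xi :
  dotp (x + tau *: unitv R i) xi = dotp x xi + tau * (xi 0 i)%:~R.
Proof.
rewrite /dotp; under eq_bigr do rewrite shiftE mulrDl.
rewrite big_split/=; congr (_ + _).
by rewrite (bigD1 i)//= eqxx big1 ?addr0// => j /negbTE ->; rewrite mul0r.
Qed.

Lemma ctorus_intD f g : ccontinuous f -> ccontinuous g ->
  ctorus_int (fun x => f x + g x) = ctorus_int f + ctorus_int g.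
Proof.
move=> [f1 f2] [g1 g2]; apply: cplx_eq.
  rewrite cReD /ctorus_int /=; under eq_fun do rewrite cReD.
  exact: torus_intD.
rewrite cImD /ctorus_int /=; under eq_fun do rewrite cImD.
exact: torus_intD.
Qed.

Lemma ctorus_intZ (z : Cplx R) f : ccontinuous f ->
  ctorus_int (fun x => z * f x) = z * ctorus_int f.
Proof.
move=> [f1 f2]; case: z => a b; rewrite /ctorus_int.
have cZ (c : R) (h : 'rV[R]_n -> R) : continuous h -> continuous (fun x => c * h x).
  move=> ch x; apply: (@continuousM _ _ (fun=> c) h); last exact: ch.
  exact: cst_continuous.
apply: cplx_eq.
  rewrite cReM /=; under eq_fun do rewrite cReM /= -mulNr.
  by rewrite torus_intD ?torus_intZ ?mulNr//; exact: cZ.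
rewrite cImM /=; under eq_fun do rewrite cImM /=.
by rewrite torus_intD ?torus_intZ//; exact: cZ.
Qed.

Lemma ctorus_int_translate i (tau : R) f : ccontinuous f ->
  (forall x, f (x + unitv R i) = f x) ->
  ctorus_int (fun x => f (x + tau *: unitv R i)) = ctorus_int f.
Proof.
move=> [f1 f2] per; rewrite /ctorus_int; congr cmk.
  by apply: (torus_int_translate _ f1) => x; rewrite per.
by apply: (torus_int_translate _ f2) => x; rewrite per.
Qed.

Lemma ctorus_int_cst (z : Cplx R) : ctorus_int (fun _ : 'rV[R]_n => z) = z.
Proof. by apply: cplx_eq; rewrite /= torus_int_cst. Qed.

(** The factor 2, here and in [cabs_ctorus_int_le_int], comes from estimating the real and imaginary
    parts separately; it only affects constants. *)
Lemma cabs_ctorus_int_le f (B : R) : ccontinuous f ->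
  (forall x, cabs (f x) <= B) -> cabs (ctorus_int f) <= 2 * B.
Proof.
move=> [f1 f2] fB; rewrite (le_trans (cabs_le_ReIm _))//= mulr_natl mulr2n.
by apply: lerD; apply: torus_int_norm_le => // x; apply: le_trans (fB x);
  [exact: cRe_le|exact: cIm_le].
Qed.

Lemma cabs_ctorus_int_le_int f : ccontinuous f ->
  cabs (ctorus_int f) <= 2 * torus_int (fun x => cabs (f x)).
Proof.
move=> cf; have [f1 f2] := cf; rewrite (le_trans (cabs_le_ReIm _))//=.
have B (h : 'rV[R]_n -> R) : continuous h -> (forall x, `|h x| <= cabs (f x)) ->
    `|torus_int h| <= torus_int (fun x => cabs (f x)).
  move=> ch hf; rewrite ler_norml -[X in X <= _ <= _]mulN1r.
  have cc := continuous_cabs cf.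
  rewrite -torus_intZ//; apply/andP; split; apply: torus_int_le => //.
  - move=> x; apply: (@continuousM _ _ (fun=> -1) (fun x => cabs (f x))).
      exact: cst_continuous.
    exact: cc.
  - by move=> x; have := hf x; rewrite ler_norml mulN1r => /andP[].
  - by move=> x; have := hf x; rewrite ler_norml => /andP[].
by rewrite mulr_natl mulr2n; apply: lerD; apply: B => // x;
  [exact: cRe_le|exact: cIm_le].
Qed.

Lemma ccontinuous_fourier f xi : ccontinuous f ->
  ccontinuous (fun x => e2pi (- dotp x xi) * f x).
Proof.
move=> cf; apply: ccontinuousM => //; under eq_fun do rewrite dotpN.
exact: ccontinuous_e2pi.
Qed.

Lemma fourierD f g xi : ccontinuous f -> ccontinuous g ->
  fourier (fun x => f x + g x) xi = fourier f xi + fourier g xi.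
Proof.
move=> cf cg; rewrite /fourier; under eq_fun do rewrite mulrDr.
by rewrite ctorus_intD//; exact: ccontinuous_fourier.
Qed.

Lemma fourierZ (z : Cplx R) f xi : ccontinuous f ->
  fourier (fun x => z * f x) xi = z * fourier f xi.
Proof.
move=> cf; rewrite /fourier; under eq_fun do rewrite mulrCA.
by rewrite ctorus_intZ//; exact: ccontinuous_fourier.
Qed.

Lemma fourierB f g xi : ccontinuous f -> ccontinuous g ->
  fourier (fun x => f x - g x) xi = fourier f xi - fourier g xi.
Proof.
move=> cf cg; rewrite fourierD//; last exact: ccontinuousN.
congr (_ + _); rewrite -mulN1r -fourierZ//; congr (fourier _ xi).
by apply/funext => x; rewrite mulN1r.
Qed.

Lemma fourier_sum (I : Type) (s : seq I) (P : pred I)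
    (F : I -> 'rV[R]_n -> Cplx R) xi : (forall k, ccontinuous (F k)) ->
  fourier (fun x => \sum_(k <- s | P k) F k x) xi =
  \sum_(k <- s | P k) fourier (F k) xi.
Proof.
move=> cF; elim: s => [|k s IH].
  rewrite big_nil; under eq_fun do rewrite big_nil.
  by rewrite /fourier; under eq_fun do rewrite mulr0; rewrite ctorus_int_cst.
rewrite big_cons; under eq_fun do rewrite big_cons.
case: (P k) => //; rewrite fourierD// ?IH//.
exact: ccontinuous_sum.
Qed.

Lemma cabs_fourier_le f xi (B : R) : ccontinuous f ->
  (forall x, cabs (f x) <= B) -> cabs (fourier f xi) <= 2 * B.
Proof.
move=> cf fB; apply: cabs_ctorus_int_le => [|x].
  exact: ccontinuous_fourier.
by rewrite cabsM cabs_e2pi mul1r.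
Qed.

Lemma cabs_fourier_le_int f xi : ccontinuous f ->
  cabs (fourier f xi) <= 2 * torus_int (fun x => cabs (f x)).
Proof.
move=> cf; rewrite (le_trans (cabs_ctorus_int_le_int _))//.
  exact: ccontinuous_fourier.
by under eq_fun do rewrite cabsM cabs_e2pi mul1r.
Qed.

Lemma fourier_modulate f xi eta :
  fourier (fun x => e2pi (dotp x xi) * f x) eta = fourier f (eta - xi).
Proof.
rewrite /fourier; congr ctorus_int; apply/funext => x.
by rewrite mulrA -e2piD !dotpN -dotpD opprB addrC.
Qed.

(** Since [xi 0 i] is an integer, the product of [f] with the exponential is still 1-periodic in
    direction [i], so translation invariance applies to the product as a whole. *)
Lemma fourier_shift i (tau : R) f xi : ccontinuous f ->
  (forall x, f (x + unitv R i) = f x) ->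
  fourier (fun x => f (x + tau *: unitv R i)) xi =
  e2pi (tau * (xi 0 i)%:~R) * fourier f xi.
Proof.
move=> cf per; rewrite /fourier.
rewrite -(@ctorus_int_translate i tau (fun x => e2pi (- dotp x xi) * f x));
  first last.
- move=> x; rewrite per; congr (_ * _).
  rewrite -[unitv R i]scale1r dotp_shift mul1r opprD e2piD -mulrNz e2pi_int.
  by rewrite mulr1.
- exact: ccontinuous_fourier.
rewrite -ctorus_intZ; last first.
  exact: (ccontinuous_shift (tau *: unitv R i) (ccontinuous_fourier xi cf)).
congr ctorus_int; apply/funext => x; rewrite mulrA -e2piD dotp_shift.
by rewrite opprD addrCA subrr addr0.
Qed.

Lemma exists_coord_neq0 xi : xi != 0 -> exists i, xi 0 i != 0.
Proof.
move=> xi0; apply/existsP; apply: contraNT xi0 => /existsPn H.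
by apply/eqP/rowP => i; rewrite [RHS]mxE; apply/eqP; have := H i; rewrite negbK.
Qed.

(** Off the diagonal no integral is computed: a constant function does not change when shifted by
    half a period of the exponential, whereas its coefficient is multiplied by [e2pi 2^-1 = -1], so
    it equals its own opposite. *)
Lemma fourier_e2pi xi eta :
  fourier (fun x => e2pi (dotp x xi)) eta = (xi == eta)%:R.
Proof.
have -> : (fun x => e2pi (dotp x xi)) = (fun x => e2pi (dotp x xi) * 1).
  by apply/funext => x; rewrite mulr1.
rewrite fourier_modulate; case: eqVneq => [->|xe].
  rewrite subrr /fourier -[RHS](@ctorus_int_cst 1); congr ctorus_int.
  by apply/funext => x; rewrite dotpN oppr0 /dotp big1 ?e2pi0 ?mulr1// => i _;
    rewrite mxE mulr0.
have [i xei] : exists i, (eta - xi) 0 i != 0.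
  by apply: exists_coord_neq0; rewrite subr_eq0 eq_sym.
set F := fourier _ _.
have F1 : F = - F.
  rewrite -mulN1r -e2piV2.
  have -> : 2^-1 = (2 * ((eta - xi) 0 i)%:~R)^-1 * ((eta - xi) 0 i)%:~R :> R.
    by rewrite invfM -mulrA mulVf ?mulr1// intr_eq0.
  by rewrite -fourier_shift//; exact: ccontinuous_cst.
by apply/eqP; rewrite -eqNr; apply/eqP/esym.
Qed.

End FourierCoefficients.

(** * Finite differences and decay of Fourier coefficients *)

Section FiniteDifferences.
Context {R : realType} {n : nat}.
Implicit Types (x : 'rV[R]_n) (i : 'I_n) (tau : R) (h : 'rV[R]_n -> R).

(** Generic in [V], so that the same operator acts on a complex function and on its real and
    imaginary parts, where the mean value theorem is available. *)
Definition fdiff (V : zmodType) i tau (h : 'rV[R]_n -> V) : 'rV[R]_n -> V :=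
  fun x => h (x + tau *: unitv R i) - h x.

Lemma shift_quotient h (v u x : 'rV[R]_n) :
  (fun t : R => t^-1 *: (((fun y => h (y + v)) \o shift x) (t *: u) - h (x + v))) =
  (fun t : R => t^-1 *: ((h \o shift (x + v)) (t *: u) - h (x + v))).
Proof. by apply/funext => t /=; rewrite /shift/= addrA. Qed.

Lemma derive_shift h (v u x : 'rV[R]_n) :
  derive (fun y => h (y + v)) x u = derive h (x + v) u.
Proof. by rewrite /derive shift_quotient. Qed.

Lemma derivable_shift h (v u x : 'rV[R]_n) :
  derivable h (x + v) u -> derivable (fun y => h (y + v)) x u.
Proof. by rewrite /derivable shift_quotient. Qed.

Lemma is_derive_line h i x (t : R) : (forall y, derivable h y (unitv R i)) ->
  is_derive t (1 : R) (fun s : R => h (x + s *: unitv R i))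
    (pd i h (x + t *: unitv R i)).
Proof.
move=> dh; pose z := x + t *: unitv R i.
have E : (fun s : R => s^-1 *:
      (((fun s : R => h (x + s *: unitv R i)) \o shift t) (s *: (1 : R)) - h z)) =
    (fun s : R => s^-1 *: ((h \o shift z) (s *: unitv R i) - h z)).
  apply/funext => s /=; rewrite /shift/=; congr (_ *: (h _ - _)).
  by rewrite /z scalerDl [s *: 1]mulr1 addrCA.
apply: DeriveDef; first by rewrite /derivable E; exact: dh.
by rewrite /derive E.
Qed.

Lemma fdiff_le h i tau (B : R) : (forall y, derivable h y (unitv R i)) ->
  (forall y, `|pd i h y| <= B) -> forall x, `|fdiff i tau h x| <= `|tau| * B.
Proof.
move=> dh hB; have pos (t : R) x : 0 <= t -> `|fdiff i t h x| <= t * B.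
  move=> t0; pose L (s : R) := h (x + s *: unitv R i).
  have [||c _] := @MVT_segment R L (fun s => pd i h (x + s *: unitv R i)) 0 t t0.
  - by move=> s _; exact: is_derive_line.
  - apply: continuous_subspaceT => s; apply: differentiable_continuous.
    by apply/derivable1_diffP; case: (is_derive_line x s dh).
  - rewrite /L scale0r addr0 subr0 /fdiff => ->.
    by rewrite normrM mulrC (ger0_norm t0) ler_wpM2l.
move=> x; have [t0|t0] := leP 0 tau; first by rewrite (ger0_norm t0); exact: pos.
rewrite (_ : fdiff i tau h x = - fdiff i (- tau) h (x + tau *: unitv R i)).
  by rewrite normrN (ltr0_norm t0) pos// oppr_ge0 ltW.
by rewrite /fdiff opprB scaleNr addrK.
Qed.

(** Only pure derivatives in direction [i] enter; this class is stable under [fdiff], as the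
    induction in [iter_fdiff_le] requires. *)
Definition line_smooth i h :=
  forall l x, derivable (pds (nseq l i) h) x (unitv R i).

Lemma pds_fdiff i tau h l : line_smooth i h ->
  pds (nseq l i) (fdiff i tau h) = fdiff i tau (pds (nseq l i) h).
Proof.
move=> sh; elim: l => [//|l IH] /=; rewrite {}IH; apply/funext => x.
rewrite /pd /fdiff -derive_shift.
rewrite -(@deriveB _ _ _ (fun y => pds (nseq l i) h (y + tau *: unitv R i)))//.
by apply: derivable_shift; exact: sh.
Qed.

Lemma line_smooth_fdiff i tau h : line_smooth i h -> line_smooth i (fdiff i tau h).
Proof.
move=> sh l x; rewrite pds_fdiff//; apply: derivableB; last exact: sh.
by apply: derivable_shift; exact: sh.
Qed.

(** Differences commute with derivatives. The innermost difference is thus moved outside [N]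
    derivatives, where the mean value theorem trades it for one more derivative and a factor
    [|tau|]. *)
Lemma iter_fdiff_le i tau h N (B : R) : line_smooth i h ->
  (forall x, `|pds (nseq N i) h x| <= B) ->
  forall x, `|iter N (fdiff i tau) h x| <= `|tau| ^+ N * B.
Proof.
elim: N h B => [|N IH] h B sh hB x; first by rewrite expr0 mul1r; exact: hB.
rewrite iterSr exprSr -mulrA; apply: IH; first exact: line_smooth_fdiff.
by move=> y; rewrite pds_fdiff//; apply: fdiff_le => //; exact: sh.
Qed.

Lemma ccontinuous_fdiff i tau (f : 'rV[R]_n -> Cplx R) :
  ccontinuous f -> ccontinuous (fdiff i tau f).
Proof.
by move=> cf; apply: ccontinuousD; [exact: ccontinuous_shift|exact: ccontinuousN].
Qed.

Lemma iter_fdiff_Re i tau (f : 'rV[R]_n -> Cplx R) N x :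
  cRe (iter N (fdiff i tau) f x) = iter N (fdiff i tau) (fun y => cRe (f y)) x.
Proof. by elim: N x => [//|N IH] x /=; rewrite /fdiff cReD cReN !IH. Qed.

Lemma iter_fdiff_Im i tau (f : 'rV[R]_n -> Cplx R) N x :
  cIm (iter N (fdiff i tau) f x) = iter N (fdiff i tau) (fun y => cIm (f y)) x.
Proof. by elim: N x => [//|N IH] x /=; rewrite /fdiff cImD cImN !IH. Qed.

Lemma fourier_iter_fdiff i (f : 'rV[R]_n -> Cplx R) N (zeta : 'rV[int]_n) :
  zeta 0 i != 0 -> ccontinuous f -> (forall x, f (x + unitv R i) = f x) ->
  fourier (iter N (fdiff i (2 * (zeta 0 i)%:~R)^-1) f) zeta =
  (- 2) ^+ N * fourier f zeta.
Proof.
move=> z0 cf per; set tau := _^-1.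
elim: N f cf per => [|N IH] f cf per; first by rewrite expr0 mul1r.
rewrite iterSr IH; first last.
- by move=> x; rewrite /fdiff per addrAC per.
- exact: ccontinuous_fdiff.
rewrite exprSr -mulrA; congr (_ * _).
rewrite fourierB//; last exact: ccontinuous_shift.
rewrite fourier_shift// /tau invfM -mulrA mulVf ?intr_eq0// mulr1 e2piV2.
by rewrite -{2}[fourier f zeta]mul1r -mulrBl; congr (_ * _); rewrite -opprD.
Qed.

(* Translating by half a period of [e2pi (x . zeta)] in direction [i]
   multiplies the coefficient at [zeta] by [-1]; hence [N] differences multiply
   it by [(-2)^N] and gain the factor [(2 |zeta_i|)^-N] from [N] derivatives. *)
Lemma cabs_fourier_decay i (f : 'rV[R]_n -> Cplx R) N (zeta : 'rV[int]_n)
    (B : R) : zeta 0 i != 0 ->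
  smooth (fun x => cRe (f x)) -> smooth (fun x => cIm (f x)) ->
  (forall x, f (x + unitv R i) = f x) ->
  (forall x, cabs (pdC (nseq N i) f x) <= B) ->
  cabs (fourier f zeta) <= 4 * B / `|(zeta 0 i)%:~R| ^+ N.
Proof.
move=> z0 s1 s2 per fB; set tau : R := (2 * (zeta 0 i)%:~R)^-1.
have cf : ccontinuous f by split; [case: (s1 [::])|case: (s2 [::])].
have B0 : 0 <= B by apply: le_trans (fB 0); exact: cabs_ge0.
have l1 : line_smooth i (fun x => cRe (f x)) by move=> l x; case: (s1 (nseq l i)).
have l2 : line_smooth i (fun x => cIm (f x)) by move=> l x; case: (s2 (nseq l i)).
have citer M : ccontinuous (iter M (fdiff i tau) f).
  by elim: M => [//|M IH] /=; exact: ccontinuous_fdiff.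
have D x : cabs (iter N (fdiff i tau) f x) <= 2 * (`|tau| ^+ N * B).
  rewrite (le_trans (cabs_le_ReIm _))// mulr_natl mulr2n lerD//.
    rewrite iter_fdiff_Re; apply: iter_fdiff_le => // y.
    by apply: le_trans (fB y); exact: (cRe_le (pdC (nseq N i) f y)).
  rewrite iter_fdiff_Im; apply: iter_fdiff_le => // y.
  by apply: le_trans (fB y); exact: (cIm_le (pdC (nseq N i) f y)).
have := cabs_fourier_le zeta (citer N) D.
rewrite fourier_iter_fdiff// cabsM cabsX cabsN.
have -> : cabs (2 : Cplx R) = 2.
  by rewrite /cabs /= addr0 expr0n addr0 sqrtr_sqr ger0_norm.
have -> : 2 * (2 * (`|tau| ^+ N * B)) = 4 * B / `|(zeta 0 i)%:~R| ^+ N / 2 ^+ N.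
  rewrite /tau normfV normrM exprVn exprMn (ger0_norm (ler0n _ 2)) invfM; ring.
have p1 : 1 <= 2 ^+ N :> R by rewrite exprn_ege1// ler1n.
have p0 : 0 < 2 ^+ N :> R by rewrite exprn_gt0.
set Q := 4 * B / _ => H.
have Q0 : 0 <= Q by rewrite divr_ge0 ?mulr_ge0// exprn_ge0.
(* Both powers of 2, the one from the [N] differences and the one inside [tau ^ N], are in favour of
   the estimate and are simply dropped. *)
have /le_trans : cabs (fourier f zeta) <= 2 ^+ N * cabs (fourier f zeta).
  by rewrite ler_peMl// cabs_ge0.
apply; apply: le_trans H _.
by rewrite ler_pdivrMr// ler_peMr.
Qed.

End FiniteDifferences.

(** * Summability as a bound on all finite sums *)

Section SummableFamilies.
Context {R : realType} {T : eqType}.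
Implicit Types (b : T -> R) (F : seq T).

(** For nonnegative [b] this is unconditional summability with total at most [M], independent of any
    enumeration of [T]. *)
Definition sum_bounded b (M : R) :=
  forall F, uniq F -> \sum_(x <- F) b x <= M.

(** Take [F0] whose sum is within [e] of the supremum of all finite sums: a disjoint [F] with a
    larger sum would push [F0 ++ F] above that supremum. *)
Lemma sum_bounded_tail b (M e : R) : sum_bounded b M -> 0 < e ->
  exists2 F0, uniq F0 & forall F, uniq F ->
    (forall x, x \in F -> x \notin F0) -> \sum_(x <- F) b x <= e.
Proof.
move=> bM e0; pose S := [set \sum_(x <- F) b x | F in [set F : seq T | uniq F]].
have hS : has_sup S.
  split; first by exists (\sum_(x <- [::]) b x); exists [::].
  by exists M => _ [F uF <-]; exact: bM.
have [_ [F0 uF0 <-] F0S] := sup_adherent e0 hS.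
exists F0 => // F uF FF0.
have : \sum_(x <- F0 ++ F) b x <= sup S.
  apply: ub_le_sup; first by case: hS.
  exists (F0 ++ F) => //=; rewrite cat_uniq uF0 uF andbT /=.
  by apply/hasPn => x /FF0.
by rewrite big_cat/=; lra.
Qed.

End SummableFamilies.

(** * Frequencies: the Japanese bracket, boxes and lattice sums *)

Section Lattice.
Context {R : realType} {n : nat}.
Implicit Types (xi eta zeta : 'rV[int]_n).

Lemma nrm2_ge0 xi : 0 <= nrm2 xi.
Proof. by apply: sumr_ge0 => i _; exact: sqr_ge0. Qed.

Lemma sqr_jbr xi : jbr R xi ^+ 2 = 1 + (nrm2 xi)%:~R.
Proof. by rewrite sqr_sqrtr// addr_ge0// ler0z nrm2_ge0. Qed.

Lemma jbr_ge1 xi : 1 <= jbr R xi.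
Proof. by rewrite -[leLHS]sqrtr1 ler_wsqrtr// lerDl ler0z nrm2_ge0. Qed.

Lemma jbr_gt0 xi : 0 < jbr R xi.
Proof. exact: lt_le_trans (jbr_ge1 xi). Qed.

Lemma jbr_ge (B : R) xi : 0 <= B -> B ^+ 2 <= (nrm2 xi)%:~R -> B <= jbr R xi.
Proof.
move=> B0 h; have g0 := ltW (jbr_gt0 xi).
rewrite -(ler_pXn2r (n := 2))// sqr_jbr; apply: le_trans h _.
by rewrite lerDr.
Qed.

Lemma coord_sqr_le_nrm2 xi i : xi 0 i ^+ 2 <= nrm2 xi.
Proof.
by rewrite /nrm2 (bigD1 i)//= lerDl; apply: sumr_ge0 => j _; exact: sqr_ge0.
Qed.

Lemma jbr_peetre xi eta : jbr R (xi + eta) <= 2 * jbr R xi * jbr R eta.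
Proof.
have g0 (z : 'rV[int]_n) : 0 <= jbr R z by exact: ltW (jbr_gt0 z).
rewrite -(ler_pXn2r (n := 2))// ?nnegrE ?mulr_ge0// !exprMn !sqr_jbr.
have : nrm2 (xi + eta) <= 2 * nrm2 xi + 2 * nrm2 eta.
  rewrite /nrm2 !mulr_sumr -big_split; apply: ler_sum => i _ /=; rewrite !mxE.
  by have := sqr_ge0 (xi 0 i - eta 0 i); nra.
rewrite -(ler_int R) rmorphD/= !rmorphM/=.
have := nrm2_ge0 xi; have := nrm2_ge0 eta; rewrite -!(ler0z R).
by set a : R := (nrm2 xi)%:~R; set b : R := (nrm2 eta)%:~R => ? ? ?; nra.
Qed.

(** The lattice points of max-norm at most [N], listed through [freq_of] because the sums in [block]
    and [Ta_partial] are indexed that way. *)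
Definition box (N : nat) : seq 'rV[int]_n :=
  [seq freq_of k | k : {ffun 'I_n -> 'I_(2 * N).+1}].

Lemma freq_of_inj N : injective (@freq_of n N).
Proof.
move=> k1 k2 /rowP E; apply/ffunP => i; have := E i; rewrite !mxE.
by move/addIr => [] /val_inj.
Qed.

Lemma box_uniq N : uniq (box N).
Proof. by rewrite map_inj_uniq ?enum_uniq//; exact: freq_of_inj. Qed.

Lemma mem_box N xi : (xi \in box N) = [forall i, (absz (xi 0%R i) <= N)%N].
Proof.
apply/idP/forallP => [/mapP[k _ ->] i|H].
  by rewrite mxE; move: (nat_of_ord (k i)) (ltn_ord (k i)) => c; lia.
apply/mapP; exists [ffun i => inord (absz (xi 0 i + N%:Z))]; first by rewrite mem_enum.
apply/rowP => i; rewrite mxE ffunE; move: (xi 0 i) (H i) => c /= Hc.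
by rewrite inordK; lia.
Qed.

Lemma size_box N : size (box N) = ((2 * N).+1 ^ n)%N.
Proof. by rewrite size_map -cardE card_ffun !card_ord. Qed.

Lemma sum_box (V : nmodType) N (P : pred 'rV[int]_n) (F : 'rV[int]_n -> V) :
  \sum_(k : {ffun 'I_n -> 'I_(2 * N).+1} | P (freq_of k)) F (freq_of k) =
  \sum_(xi <- box N | P xi) F xi.
Proof. by rewrite big_image_cond. Qed.

Lemma jbr_ge_coord (N : nat) xi i : (N <= absz (xi 0%R i))%N -> N%:R <= jbr R xi.
Proof.
move=> Nxi; apply: jbr_ge => //.
apply: (@le_trans _ _ ((xi 0 i ^+ 2)%:~R)); last by rewrite ler_int coord_sqr_le_nrm2.
rewrite [N%:R]pmulrn -rmorphXn ler_int -(real_normK (num_real (xi 0 i))).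
by rewrite ler_pXn2r// ?nnegrE//; lia.
Qed.

Lemma jbr_ge_notin_box N xi : xi \notin box N -> N%:R <= jbr R xi.
Proof.
rewrite mem_box negb_forall => /existsP[i /= h].
move: h; rewrite -ltnNge => h.
by apply: (@jbr_ge_coord _ _ i); exact: ltnW.
Qed.

(** Decompose into shells between the boxes of radius [2^J] and [2^(J+1)]. Such a shell has at most
    [8^n 2^((J+1)n) = 16^n 2^(Jn)] points, each of weight at most [2^(-Js)], which gives a geometric
    series of ratio [th = 2^(n-s) < 1]. The [3^n] counts the box of radius 1. *)
Lemma jbr_sum_bounded (s : R) : n%:R < s ->
  exists M, @sum_bounded R 'rV[int]_n (fun xi => powR (jbr R xi) (- s)) M.
Proof.
move=> ns; pose th : R := powR 2 (n%:R - s).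
have s0 : 0 < s by rewrite (le_lt_trans _ ns).
have th0 : 0 < th by rewrite powR_gt0.
have th1 : th < 1.
  have := @gt0_ltr_powR R (s - n%:R) _ 1 2; rewrite powR1 !nnegrE subr_gt0.
  move=> /(_ ns ler01 (ler0n _ 2)); rewrite ltr1n => /(_ isT) h.
  by rewrite /th -opprB powRN invf_lt1// (lt_trans _ h).
pose b xi : R := powR (jbr R xi) (- s).
have b0 xi : 0 <= b xi by exact: powR_ge0.
have b_le (B : R) xi : 0 < B -> B <= jbr R xi -> b xi <= powR B (- s).
  move=> B0 Bx; rewrite /b !powRN lef_pV2 ?posrE ?powR_gt0 ?jbr_gt0//.
  by rewrite ge0_ler_powR ?nnegrE// ltW// jbr_gt0.
have count J (F : seq 'rV[int]_n) : uniq F -> {subset F <= box (2 ^ J)} ->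
    (size F)%:R <= (8 ^ n)%:R * powR 2 (J%:R * n%:R) :> R.
  move=> uF sF; rewrite powRrM !powR_mulrn// -!natrX -natrM ler_nat.
  apply: leq_trans (uniq_leq_size uF sF) _.
  rewrite size_box -expnMn; case: (n) => // n'; rewrite leq_exp2r//.
  by have := expn_gt0 2 J; rewrite /=; lia.
have step J (F : seq 'rV[int]_n) : uniq F ->
    (forall xi, xi \in F -> xi \in box (2 ^ J)) ->
    \sum_(xi <- F) b xi <= (3 ^ n)%:R + (16 ^ n)%:R * ((1 - th ^+ J) / (1 - th)).
  have thn : 1 - th != 0 by rewrite subr_eq0 eq_sym lt_eqF.
  elim: J F => [|J IH] F uF sF.
    rewrite expr0 subrr mul0r mulr0 addr0.
    apply: (@le_trans _ _ (\sum_(xi <- F) 1)).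
      apply: ler_sum => xi _; rewrite (le_trans (b_le 1 xi _ _))//.
        exact: jbr_ge1.
      by rewrite powR1.
    rewrite big_const_seq count_predT iter_addr_0 ler_nat.
    by have := uniq_leq_size uF sF; rewrite size_box.
  rewrite (bigID (fun xi => xi \in box (2 ^ J)))/=.
  rewrite -[X in X + _]big_filter -[X in _ + X]big_filter.
  have -> : (1 - th ^+ J.+1) / (1 - th) = (1 - th ^+ J) / (1 - th) + th ^+ J.
    by rewrite exprS; field.
  rewrite mulrDr addrA; apply: lerD.
    apply: IH; first exact: filter_uniq.
    by move=> xi; rewrite mem_filter => /andP[].
  set G := [seq xi <- F | xi \notin box (2 ^ J)].
  apply: (@le_trans _ _ (\sum_(xi <- G) powR 2 (- (J%:R * s)))).
    rewrite big_seq [leRHS]big_seq; apply: ler_sum => xi.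
    rewrite mem_filter => /andP[xiJ _]; rewrite -mulrN powRrM powR_mulrn//.
    apply: b_le; first by rewrite exprn_gt0.
    by rewrite -natrX; exact: jbr_ge_notin_box.
  rewrite big_const_seq count_predT iter_addr_0 -[leLHS]mulr_natl.
  have -> : (16 ^ n)%:R * th ^+ J =
      ((8 ^ n)%:R * powR 2 (J.+1%:R * n%:R)) * powR 2 (- (J%:R * s)) :> R.
    rewrite -mulrA -powRD ?pnatr_eq0 ?implybT//.
    rewrite (_ : _ - _ = n%:R + (n%:R - s) * J%:R); last by rewrite -natr1; ring.
    rewrite powRD ?pnatr_eq0 ?implybT// mulrA powRrM !powR_mulrn ?powR_ge0//.
    by congr (_ * _); rewrite -natrX -natrM -expnMn.
  rewrite ler_wpM2r ?powR_ge0//.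
  apply: count; first exact: filter_uniq.
  by move=> xi; rewrite mem_filter => /andP[_ /sF].
exists ((3 ^ n)%:R + (16 ^ n)%:R / (1 - th)) => F uF.
have [J FJ] : exists J, forall xi, xi \in F -> xi \in box (2 ^ J).
  exists (\max_(xi <- F) \max_(i < n) absz (xi 0%R i))%N => xi xiF; rewrite mem_box.
  apply/forallP => i; apply: leq_trans (ltnW (ltn_expl _ _)); last by [].
  by apply: leq_trans (leq_bigmax_seq _ xiF isT); exact: leq_bigmax.
apply: (le_trans (step J F uF FJ)); rewrite lerD2l ler_wpM2l//.
rewrite ler_pdivrMr ?subr_gt0// mulVf ?lerBlDr ?lerDl ?exprn_ge0 ?ltW//.
by rewrite subr_eq0 eq_sym lt_eqF.
Qed.

(** For a coordinate of maximal modulus [|xi|^2 <= n xi_i^2], and [1 <= xi_i^2] since it is a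
    nonzero integer. This turns decay in one coordinate into decay in the bracket. *)
Lemma jbr_le_coord xi : xi != 0 ->
  exists2 i, xi 0 i != 0 & jbr R xi ^+ 2 <= n.+1%:R * `|(xi 0 i)%:~R| ^+ 2.
Proof.
move=> /exists_coord_neq0 xi1; have [i0 _] := xi1.
pose i := [arg max_(i > i0) absz (xi 0 i)].
have imax j : (absz (xi 0%R j) <= absz (xi 0%R i))%N.
  by rewrite /i; case: arg_maxnP => // l _ /(_ j isT).
have i_neq0 : xi 0 i != 0.
  by have [j] := xi1; have := imax j; rewrite -!absz_gt0; lia.
exists i => //; rewrite sqr_jbr real_normK ?num_real//.
have : nrm2 xi <= n%:Z * xi 0 i ^+ 2.
  apply: (@le_trans _ _ (\sum_(j < n) xi 0 i ^+ 2)); last first.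
    by rewrite sumr_const card_ord -[leLHS]mulr_natl natz.
  apply: ler_sum => j _; rewrite -(real_normK (num_real (xi 0 j))).
  rewrite -(real_normK (num_real (xi 0 i))).
  by have := imax j; rewrite ler_pXn2r ?nnegrE//; lia.
have : 1 <= xi 0 i ^+ 2 by move: i_neq0; nia.
rewrite -!(ler_int R) !rmorphM/= -natr1; nra.
Qed.

End Lattice.

(** * Besov norms against weighted sums and single coefficients *)

Section BesovNorm.
Context {R : realType} {n : nat}.
Implicit Types (x : 'rV[R]_n) (xi eta : 'rV[int]_n) (f : 'rV[R]_n -> Cplx R).
Implicit Types (c y : 'rV[int]_n -> Cplx R).

Lemma continuous_powR_norm (s : R) : 0 < s -> continuous (fun a : R => powR `|a| s).
Proof.
move=> s0 a; have [->|a0] := eqVneq a 0; last first.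
  apply: (@continuous_comp _ _ _ (fun a : R => `|a|) (fun a => powR a s)).
    exact: norm_continuous.
  apply: differentiable_continuous; apply/derivable1_diffP.
  by apply: derivable_powR; rewrite in_itv/= andbT normr_gt0.
apply/cvgrPdist_lt => e e0.
have p0 : 0 < powR e s^-1 by rewrite powR_gt0.
have := @nbhs0_lt _ R^o _ p0; apply: filterS => b bp.
rewrite normr0 powR0 ?gt_eqF// sub0r normrN ger0_norm ?powR_ge0//.
rewrite -[ltRHS](powRr1 (ltW e0)) -(mulVf (lt0r_neq0 s0)) powRrM.
by rewrite gt0_ltr_powR ?nnegrE ?powR_ge0.
Qed.

Lemma continuous_powR_cabs f (s : R) : 0 < s -> ccontinuous f ->
  continuous (fun x => powR (cabs (f x)) s).
Proof.
move=> s0 /continuous_cabs cf.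
have -> : (fun x => powR (cabs (f x)) s) = (fun x => powR `|cabs (f x)| s).
  by apply/funext => x; rewrite ger0_norm// cabs_ge0.
move=> x; apply: (@continuous_comp _ _ _ (fun x => cabs (f x))
  (fun a : R => powR `|a| s)).
  exact: cf.
exact: continuous_powR_norm.
Qed.

Lemma powRK (a s : R) : 0 <= a -> 0 < s -> powR (powR a s) s^-1 = a.
Proof. by move=> a0 s0; rewrite -powRrM mulfV ?gt_eqF// powRr1. Qed.

Lemma in_itv0y (u : \bar R) : (0 <= u)%E -> u \in `[0%E, +oo%E].
Proof. by move=> u0; rewrite in_itv/= u0 leey. Qed.

Lemma Lpnorm_ge0 p f : (0 <= Lpnorm p f)%E.
Proof.
case: p => [s| |] //=; first by rewrite lee_fin powR_ge0.
apply: (@le_trans _ _ (cabs (f 0))%:E); first by rewrite lee_fin cabs_ge0.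
by apply: ereal_sup_ubound; exists 0 => // i; rewrite mxE lexx ler01.
Qed.

(** The torus has total mass 1, so the bound is the same for every [p]. *)
Lemma Lpnorm_le (p : \bar R) f (B : R) : (1%:E <= p)%E -> ccontinuous f ->
  (forall x, cabs (f x) <= B) -> (Lpnorm p f <= B%:E)%E.
Proof.
move=> + cf fB; have B0 : 0 <= B by apply: le_trans (fB 0); exact: cabs_ge0.
case: p => [s| |] //=; last first.
  by move=> _; apply: ub_ereal_sup => _ [x _ <-]; rewrite lee_fin.
rewrite !lee_fin => s1; have s0 : 0 < s by rewrite (lt_le_trans ltr01).
rewrite -[leRHS](powRK B0 s0) ge0_ler_powR ?nnegrE ?powR_ge0 ?invr_ge0 ?(ltW s0)//.
  rewrite -(@torus_int_cst R n 0) torus_int_le//; first exact: cst_continuous.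
    exact: continuous_powR_cabs.
  by move=> x; exact: powR_ge0.
rewrite -(@torus_int_cst R n (powR B s)) torus_int_le//.
- exact: continuous_powR_cabs.
- exact: cst_continuous.
by move=> x; rewrite ge0_ler_powR ?nnegrE ?cabs_ge0 ?(ltW s0).
Qed.

Definition dyadic (m : nat) : seq 'rV[int]_n :=
  [seq xi <- box (2 ^ m.+1) | inblock m xi].

Lemma dyadic_uniq m : uniq (dyadic m).
Proof. by rewrite filter_uniq// box_uniq. Qed.

Lemma inblock_lt m xi : inblock m xi -> nrm2 xi < (4 ^ m.+1)%N%:Z.
Proof. by rewrite /inblock; case: m => [|m] //= /andP[]. Qed.

Lemma inblock_box m xi : inblock m xi -> xi \in box (2 ^ m.+1).
Proof.
move=> /inblock_lt xim; rewrite mem_box; apply/forallP => i.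
rewrite leqNgt; apply/negP => h; have := coord_sqr_le_nrm2 xi i.
have : (4 ^ m.+1 = 2 ^ m.+1 * 2 ^ m.+1)%N by rewrite -expnMn.
move: (2 ^ m.+1)%N h xim => N; move: (nrm2 xi) (xi 0 i) => q z h xim E.
rewrite E in xim; nia.
Qed.

Lemma mem_dyadic m xi : (xi \in dyadic m) = inblock m xi.
Proof.
by rewrite mem_filter; case: (boolP (inblock m xi)) => //= /inblock_box.
Qed.

(** Take the least [m] with [|xi|^2 < 4^(m+1)]; minimality gives the lower bound. Block 0 has no
    lower bound, so the zero frequency is covered too. *)
Lemma exists_inblock xi : exists m, inblock m xi.
Proof.
have ex : exists m, nrm2 xi < (4 ^ m.+1)%N%:Z.
  exists (absz (nrm2 xi)); have := ltn_expl (absz (nrm2 xi)).+1 (isT : 1 < 4)%N.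
  by move: (nrm2 xi) => q; lia.
case: (ex_minnP ex) => m hm mmin; exists m; rewrite /inblock.
case: m hm mmin => [//|m] hm mmin /=; rewrite hm andbT leNgt; apply/negP => h.
by have := mmin m h; rewrite ltnn.
Qed.

Lemma blockE m c x :
  block m c x = \sum_(xi <- dyadic m) e2pi (dotp x xi) * c xi.
Proof.
rewrite /block (sum_box _ (inblock m) (fun xi => e2pi (dotp x xi) * c xi)).
by rewrite big_filter.
Qed.

Lemma ccontinuous_block m c : ccontinuous (block m c).
Proof.
have -> : block m c = fun x => \sum_(xi <- dyadic m) e2pi (dotp x xi) * c xi.
  by apply/funext => x; exact: blockE.
apply: ccontinuous_sum => xi; apply: ccontinuousM; last exact: ccontinuous_cst.
exact: ccontinuous_e2pi.
Qed.

Lemma fourier_block m c xi : inblock m xi -> fourier (block m c) xi = c xi.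
Proof.
move=> xim; have -> : block m c =
    fun x => \sum_(eta <- dyadic m) c eta * e2pi (dotp x eta).
  by apply/funext => x; rewrite blockE; apply: eq_bigr => eta _; rewrite mulrC.
rewrite fourier_sum; last first.
  by move=> eta; apply: ccontinuousM; [exact: ccontinuous_cst|exact: ccontinuous_e2pi].
under eq_bigr do rewrite (fourierZ _ _ (ccontinuous_e2pi _)) fourier_e2pi.
rewrite (bigD1_seq xi)/= ?dyadic_uniq ?mem_dyadic// eqxx mulr1 big1 ?addr0//.
by move=> eta /negbTE ->; rewrite mulr0.
Qed.

Lemma cabs_block_le m c x : cabs (block m c x) <= \sum_(xi <- dyadic m) cabs (c xi).
Proof.
rewrite blockE (le_trans (cabs_sum _ _ _))//.
by apply: ler_sum => xi _; rewrite cabsM cabs_e2pi mul1r.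
Qed.

Lemma inblock_jbr m xi : inblock m xi -> 2 ^+ m <= jbr R xi.
Proof.
case: m => [|m] /=; first by rewrite expr0 jbr_ge1.
rewrite /inblock /= => /andP[h _]; apply: jbr_ge; first by rewrite exprn_ge0.
have -> : (2 ^+ m.+1) ^+ 2 = ((4 ^ m.+1)%N%:Z)%:~R :> R.
  by rewrite -pmulrn natrX -exprM mulnC exprM -natrX.
by rewrite ler_int.
Qed.

Section UpperBound.
Variables (w M : R) (p q : \bar R) (y : 'rV[int]_n -> Cplx R).
Hypotheses (w0 : 0 <= w) (p1 : (1%:E <= p)%E) (q1 : (1%:E <= q)%E).
Hypothesis yM : sum_bounded (fun xi => powR (jbr R xi) w * cabs (y xi)) M.

Let b m := \sum_(xi <- dyadic m) powR (jbr R xi) w * cabs (y xi).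

Let b_ge0 m : 0 <= b m.
Proof. by apply: sumr_ge0 => xi _; rewrite mulr_ge0 ?powR_ge0 ?cabs_ge0. Qed.

Let M_ge0 : 0 <= M.
Proof. by have := yM (F := [::]) isT; rewrite big_nil. Qed.

Let b_le m : b m <= M.
Proof. by apply: yM; exact: dyadic_uniq. Qed.

Let sum_b_le K : \sum_(0 <= m < K) b m <= M.
Proof.
(* The first [K] blocks form one duplicate-free list. The bound [4^K] separates it from block [K];
   the clause [0 < K] covers block 0, which has no lower bound but is added to an empty list. *)
have [F [uF _ ->]] : exists F : seq 'rV[int]_n, [/\ uniq F,
    (forall xi, xi \in F -> (0 < K)%N /\ nrm2 xi < (4 ^ K)%N%:Z) &
    \sum_(0 <= m < K) b m = \sum_(xi <- F) powR (jbr R xi) w * cabs (y xi)].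
  elim: K => [|K [F [uF FK E]]]; first by exists [::]; split; rewrite ?big_nil// big_geq.
  exists (F ++ dyadic K); split.
  - rewrite cat_uniq uF dyadic_uniq andbT /=; apply/hasPn => xi.
    rewrite mem_dyadic => xiK; apply/negP => /FK[]; case: (K) xiK => // K' /=.
    by rewrite /inblock /= => /andP[h _] _; rewrite ltNge h.
  - move=> xi; rewrite mem_cat mem_dyadic => /orP[/FK[_ h]|/inblock_lt//].
    by split=> //; apply: lt_le_trans h _; rewrite lez_nat leq_exp2l.
  - by rewrite big_nat_recr//= E big_cat.
exact: yM.
Qed.

Let t m := ((powR 2 (m%:R * w))%:E * Lpnorm p (block m y))%E.

Let t_ge0 m : (0 <= t m)%E.
Proof. by rewrite mule_ge0 ?lee_fin ?powR_ge0 ?Lpnorm_ge0. Qed.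

Let t_le m : (t m <= (b m)%:E)%E.
Proof.
apply: (@le_trans _ _ ((powR 2 (m%:R * w))%:E *
    (\sum_(xi <- dyadic m) cabs (y xi))%:E)%E).
  rewrite lee_wpmul2l ?lee_fin ?powR_ge0//; apply: Lpnorm_le => //.
    exact: ccontinuous_block.
  exact: cabs_block_le.
rewrite -EFinM lee_fin /b mulr_sumr big_seq [leRHS]big_seq; apply: ler_sum => xi.
rewrite mem_dyadic => xim; rewrite ler_wpM2r ?cabs_ge0//.
rewrite powRrM powR_mulrn// ge0_ler_powR ?nnegrE ?exprn_ge0//.
  exact: ltW (jbr_gt0 xi).
exact: inblock_jbr.
Qed.

(** On block [m] the weight [2^(mw)] is at most [<xi>^w], and the [L^p] norm is at most the sum of
    the moduli of the coefficients; this bounds the terms by [b m], of total at most [M]. What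
    remains is the embedding of [l^1] into [l^q]. *)
Lemma besov_norm_le : (besov_norm w p q y <= M%:E)%E.
Proof.
rewrite /besov_norm -/t; case: q q1 => [s| |] //=; last first.
  move=> _; apply: ub_ereal_sup => _ [m _ <-].
  by apply: le_trans (t_le m) _; rewrite lee_fin b_le.
rewrite lee_fin => s1; have s0 : 0 < s by rewrite (lt_le_trans ltr01).
have S : (\sum_(0 <= m <oo) poweR (t m) s <= (powR M s)%:E)%E.
  apply: lime_le; first by apply: is_cvg_nneseries => m _ _; exact: poweR_ge0.
  apply: nearW => K; apply: (@le_trans _ _ (\sum_(0 <= m < K) (powR (b m) s)%:E)%E).
    apply: lee_sum => m _; rewrite -poweR_EFin gt0_ler_poweR ?(ltW s0)//.
    - by rewrite in_itv/= leey t_ge0.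
    - by rewrite in_itv/= leey lee_fin b_ge0.
  rewrite sumEFin lee_fin.
  (* [b^s = b b^(s-1) <= b M^(s-1)], because each [b m] is at most [M] and [s >= 1]. *)
  apply: (@le_trans _ _ (\sum_(0 <= m < K) b m * powR M (s - 1))).
    apply: ler_sum => m _; rewrite -(mulr_powRB1 (b_ge0 m) s0).
    by rewrite ler_wpM2l// ge0_ler_powR ?nnegrE ?subr_ge0.
  by rewrite -mulr_suml -(mulr_powRB1 M_ge0 s0) ler_wpM2r// powR_ge0.
apply: (@le_trans _ _ (poweR (powR M s)%:E s^-1)).
  rewrite gt0_ler_poweR ?invr_ge0 ?(ltW s0)//.
  - by rewrite in_itv/= leey nneseries_ge0// => m _ _; exact: poweR_ge0.
  - by rewrite in_itv/= leey lee_fin powR_ge0.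
by rewrite poweR_EFin powRK.
Qed.

End UpperBound.

Lemma besov_norm_ge0 (w : R) (p q : \bar R) c : (0 <= besov_norm w p q c)%E.
Proof.
rewrite /besov_norm; case: q => [s| |] //=; first exact: poweR_ge0.
apply: (@le_trans _ _ ((powR 2 (0%:R * w))%:E * Lpnorm p (block 0 c))%E).
  by rewrite mule_ge0 ?lee_fin ?powR_ge0 ?Lpnorm_ge0.
by apply: ereal_sup_ubound; exists 0%N.
Qed.

(* Jensen's inequality up to a constant, from [a <= t + t^(1-p) a^p] for all
   [t > 0]. *)
Lemma cabs_fourier_le_Lpnorm (p : R) f xi : 1 <= p -> ccontinuous f ->
  ((cabs (fourier f xi))%:E <= 4%:E * Lpnorm p%:E f)%E.
Proof.
move=> p1 cf; have p0 : 0 < p by rewrite (lt_le_trans ltr01).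
rewrite /= -EFinM lee_fin; set I := torus_int _.
have cp : continuous (fun x => powR (cabs (f x)) p) by exact: continuous_powR_cabs.
have I0 : 0 <= I.
  rewrite -(@torus_int_cst R n 0) torus_int_le//; first exact: cst_continuous.
  by move=> x; exact: powR_ge0.
have H (t : R) : 0 < t -> cabs (fourier f xi) <= 2 * (t + powR t (1 - p) * I).
  move=> t0; apply: le_trans (cabs_fourier_le_int xi cf) _; rewrite ler_wpM2l//.
  have cZ : continuous (fun x => powR t (1 - p) * powR (cabs (f x)) p).
    move=> x; apply: (@continuousM _ _ (fun=> powR t (1 - p))
      (fun x => powR (cabs (f x)) p)); [exact: cst_continuous|exact: cp].
  rewrite -[X in _ <= X + _](@torus_int_cst R n) -torus_intZ// -torus_intD//;
    last exact: cst_continuous.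
  apply: torus_int_le.
  - exact: continuous_cabs.
  - move=> x; apply: (@continuousD _ _ _ (fun=> t)
      (fun x => powR t (1 - p) * powR (cabs (f x)) p)).
      exact: cst_continuous.
    exact: cZ.
  - move=> x; have [ft|tf] := leP (cabs (f x)) t.
      by rewrite (le_trans ft)// lerDl mulr_ge0 ?powR_ge0.
    rewrite -[leLHS]add0r lerD ?(ltW t0)//.
    rewrite -opprB powRN mulrC ler_pdivlMr ?powR_gt0//.
    rewrite -(mulr_powRB1 (cabs_ge0 _) p0) ler_wpM2l ?cabs_ge0//.
    by rewrite ge0_ler_powR ?nnegrE ?subr_ge0 ?(ltW t0) ?(ltW tf) ?cabs_ge0.
have [I_eq0|I_neq0] := eqVneq I 0.
  rewrite I_eq0 powR0 ?invr_eq0 ?gt_eqF// mulr0.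
  apply/ler_addgt0Pr => e e0; have := H (e / 2) (divr_gt0 e0 (ltr0n _ 2)).
  by rewrite I_eq0 mulr0; lra.
(* The choice [t = I^(1/p)] makes both terms equal to [I^(1/p)], whence the constant
   [2 (1 + 1) = 4]. For [I = 0] this [t] would not be positive, and arbitrarily small [t] served
   instead. *)
have t0 : 0 < powR I p^-1 by rewrite powR_gt0// lt0r I_neq0.
have E : powR (powR I p^-1) (1 - p) * I = powR I p^-1.
  rewrite -powRrM -[X in _ * X](powRr1 I0) -powRD ?I_neq0 ?implybT//.
  by congr powR; field; rewrite gt_eqF.
by have := H _ t0; rewrite E => h; apply: le_trans h _; lra.
Qed.

(** The coefficient is read off the block containing [xi]. Since [w >= 0] its weight [2^(mw)] is at
    least 1, and one term of a nonnegative sequence is at most its [l^q] norm for any [q > 0]. *)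
Lemma cabs_le_besov_norm (w p q : R) c xi : 0 <= w -> 1 <= p -> 0 < q ->
  ((cabs (c xi))%:E <= 4%:E * besov_norm w p%:E q%:E c)%E.
Proof.
move=> w0 p1 q0; have [m xim] := exists_inblock xi.
rewrite -(fourier_block c xim).
apply: le_trans (cabs_fourier_le_Lpnorm _ p1 (ccontinuous_block m c)) _.
rewrite lee_wpmul2l ?lee_fin// /besov_norm.
pose t k := ((powR 2 (k%:R * w))%:E * Lpnorm p%:E (block k c))%E.
rewrite -/t; set L := Lpnorm _ _.
have t_ge0 k : (0 <= t k)%E by rewrite /t mule_ge0 ?lee_fin ?powR_ge0 ?Lpnorm_ge0.
apply: (@le_trans _ _ (t m)).
  rewrite /t -/L -[leLHS]mul1e lee_wpmul2r ?Lpnorm_ge0// lee_fin.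
  by rewrite -[leLHS](powRr0 2) ler_powR ?ler1n// mulr_ge0.
have tE : poweR (poweR (t m) q) q^-1 = t m.
  by rewrite -poweRrM mulfV ?gt_eqF// poweRe1.
rewrite -[leLHS]tE; apply: gt0_ler_poweR; rewrite ?invr_ge0 ?(ltW q0)//.
- exact/in_itv0y/poweR_ge0.
- by apply/in_itv0y/nneseries_ge0 => k _ _; exact: poweR_ge0.
apply: le_trans (nneseries_lim_ge m.+1 _); last by move=> k _ _; exact: poweR_ge0.
rewrite big_nat_recr// -/(t m) leeDr//; apply: sume_ge0 => k _; exact: poweR_ge0.
Qed.

End BesovNorm.

(** * Fourier coefficients of the symbol *)

Section SymbolEstimates.
Context {R : realType} {n : nat}.
Implicit Types (x : 'rV[R]_n) (xi eta zeta : 'rV[int]_n) (i j : 'I_n).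

(** The multi-index [N e_i]: from the symbol class only orders zero and [2k] in a single direction
    are extracted. *)
Definition single (N : nat) i : 'I_n -> nat := fun j => if j == i then N else 0%N.

Lemma mlen_single N i : mlen (single N i) = N.
Proof.
rewrite /mlen (bigD1 i)//= /single eqxx big1 ?addn0// => j.
by move=> /negbTE ->.
Qed.

Lemma beta_seq_single N i : beta_seq (single N i) = nseq N i.
Proof.
rewrite /beta_seq.
have H (s : seq 'I_n) : uniq s ->
    flatten [seq nseq (single N i j) j | j <- s] = if i \in s then nseq N i else [::].
  elim: s => [//|j s IH] /= /andP[js us]; rewrite {}IH// inE /single eq_sym.
  case: (eqVneq i j) => [->|//]; by rewrite (negbTE js) cats0.
by rewrite H ?enum_uniq// mem_enum.
Qed.

(** At [zeta = 0] the sup bound suffices; otherwise [2k] differences are taken along the largest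
    coordinate. The even order lets the comparison of squares in [jbr_le_coord] be raised to the
    power [k], whence [(n+1)^k]. *)
Lemma cabs_fourier_jbr (f : 'rV[R]_n -> Cplx R) (k : nat) (B : R) zeta :
  smooth (fun x => cRe (f x)) -> smooth (fun x => cIm (f x)) ->
  (forall x i, f (x + unitv R i) = f x) ->
  (forall x, cabs (f x) <= B) ->
  (forall i x, cabs (pdC (nseq (2 * k) i) f x) <= B) ->
  cabs (fourier f zeta) <= 4 * n.+1%:R ^+ k * B * powR (jbr R zeta) (- (2 * k)%:R).
Proof.
move=> s1 s2 per fB dB; have B0 : 0 <= B by apply: le_trans (fB 0); exact: cabs_ge0.
have n1 : 1 <= n.+1%:R ^+ k :> R by rewrite exprn_ege1// ler1n.
have j0 := jbr_gt0 (R := R) zeta.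
rewrite powRN powR_mulrn ?(ltW j0)// exprM.
have [z0|z0] := eqVneq zeta 0.
  have -> : jbr R zeta ^+ 2 = 1.
    rewrite sqr_jbr z0 /nrm2 big1 ?addr0// => i _.
    by rewrite mxE expr0n.
  have cf : ccontinuous f by split; [case: (s1 [::])|case: (s2 [::])].
  rewrite expr1n invr1 mulr1; apply: le_trans (cabs_fourier_le zeta cf fB) _.
  rewrite ler_wpM2r//; apply: (@le_trans _ _ (4 * 1)); first by lra.
  by rewrite ler_wpM2l.
have [i zi zj] := jbr_le_coord (R := R) z0.
have := cabs_fourier_decay (i := i) zi s1 s2 (per^~ i) (dB i).
set z : R := (zeta 0 i)%:~R => H; apply: le_trans H _; rewrite exprM.
have zp : 0 < `|z| ^+ 2 by rewrite exprn_gt0// normr_gt0 intr_eq0.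
have jp : 0 < jbr R zeta ^+ 2 by rewrite exprn_gt0.
have key : ((`|z| ^+ 2) ^+ k)^-1 <= n.+1%:R ^+ k * ((jbr R zeta ^+ 2) ^+ k)^-1.
  rewrite ler_pdivlMr ?(exprn_gt0 _ jp)// mulrC.
  rewrite ler_pdivrMr ?(exprn_gt0 _ zp)// -exprMn.
  by apply: lerXn2r zj; rewrite nnegrE ?mulr_ge0// ltW.
rewrite [leRHS](_ : _ = 4 * B * (n.+1%:R ^+ k * ((jbr R zeta ^+ 2) ^+ k)^-1)).
  by rewrite ler_wpM2l// mulr_ge0.
by ring.
Qed.

Section Symbol.
Variables (m rho delta : R) (k : nat) (a : 'rV[R]_n -> 'rV[int]_n -> Cplx R).
Hypothesis delta0 : 0 <= delta.
Hypothesis sa : symbol_class m rho delta (2 * k) a.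

Lemma ccontinuous_symbol xi : ccontinuous (a^~ xi).
Proof. by case: sa => /(_ xi)[s1 s2] _; split; [case: (s1 [::])|case: (s2 [::])]. Qed.

Lemma symbol_le : exists2 C, 0 <= C &
  forall x xi, cabs (a x xi) <= C * powR (jbr R xi) m.
Proof.
case: sa => _ [_ sb].
have b0 : mlen (fun _ : 'I_n => 0%N) = 0%N by rewrite /mlen big1.
have [|C HC] := sb (fun _ => 0%N); first by rewrite b0.
have b1 : beta_seq (fun _ : 'I_n => 0%N) = [::].
  by rewrite /beta_seq; elim: (enum _).
exists `|C| => // x xi; have := HC x xi; rewrite b0 mulr0 addr0 b1.
have -> : pdC [::] (a^~ xi) x = a x xi by apply: cplx_eq.
move=> h; apply: le_trans h _; rewrite ler_wpM2r ?powR_ge0//; exact: ler_norm.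
Qed.

Lemma symbol_coefficient_le : exists2 C, 0 <= C & forall xi eta,
  cabs (fourier (fun x => e2pi (dotp x xi) * a x xi) eta) <=
  C * powR (jbr R xi) (m + 2 * k%:R * delta) * powR (jbr R (eta - xi)) (- (2 * k)%:R).
Proof.
have [C0 C00 HC0] := symbol_le; have [sm [per sb]] := sa.
have /choice[D HD] : forall i, exists C : R, forall x xi,
    cabs (pdC (nseq (2 * k) i) (a^~ xi) x) <=
    C * powR (jbr R xi) (m + delta * (2 * k)%:R).
  move=> i; have [|C] := sb (single (2 * k) i); first by rewrite mlen_single.
  by rewrite mlen_single beta_seq_single; exists C.
pose C := C0 + \sum_i `|D i|.
have Cge0 : 0 <= C by rewrite addr_ge0// sumr_ge0.
have E : m + delta * (2 * k)%:R = m + 2 * k%:R * delta by rewrite natrM; ring.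
exists (4 * n.+1%:R ^+ k * C) => [|xi eta]; first by rewrite !mulr_ge0// exprn_ge0.
rewrite fourier_modulate -[_ * C * _]mulrA.
have [s1 s2] := sm xi; apply: cabs_fourier_jbr => //.
- move=> x; apply: le_trans (HC0 x xi) _.
  apply: ler_pM; rewrite ?powR_ge0// ?lerDl ?sumr_ge0//.
  (* [delta >= 0] allows the order-zero bound [<xi>^m] to be relaxed to the exponent [m + 2k delta]
     of the derivatives. *)
  by rewrite ler_powR ?jbr_ge1// lerDl !mulr_ge0.
- move=> i x; apply: le_trans (HD i x xi) _; rewrite E ler_wpM2r ?powR_ge0//.
  rewrite (le_trans (ler_norm _))// /C (bigD1 i)//= addrCA lerDl.
  by rewrite addr_ge0// sumr_ge0.
Qed.

Lemma symbol_weighted_sum_le (w : R) : 0 <= w < 2 * k%:R - n%:R ->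
  exists2 K, 0 <= K & forall xi, sum_bounded
    (fun eta => powR (jbr R eta) w *
       cabs (fourier (fun x => e2pi (dotp x xi) * a x xi) eta))
    (K * powR (jbr R xi) (m + 2 * k%:R * delta + w)).
Proof.
move=> /andP[w0 wk]; have [C C0 HC] := symbol_coefficient_le.
have [|M HM] := @jbr_sum_bounded R n (2 * k%:R - w); first by lra.
have M0 : 0 <= M by have := HM [::] isT; rewrite big_nil.
exists (powR 2 w * C * M) => [|xi F uF]; first by rewrite !mulr_ge0// powR_ge0.
set mu := m + _.
have J xi' := ltW (jbr_gt0 (R := R) (n := n) xi').
apply: (@le_trans _ _ (\sum_(eta <- F) powR 2 w * C * powR (jbr R xi) (mu + w) *
    powR (jbr R (eta - xi)) (- (2 * k%:R - w)))).
  apply: ler_sum => eta _.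
  apply: (@le_trans _ _ (powR (2 * jbr R xi * jbr R (eta - xi)) w *
     (C * powR (jbr R xi) mu * powR (jbr R (eta - xi)) (- (2 * k)%:R)))).
    apply: ler_pM; rewrite ?powR_ge0 ?cabs_ge0//.
    rewrite ge0_ler_powR ?nnegrE ?mulr_ge0 ?J//.
    by have := jbr_peetre (R := R) xi (eta - xi); rewrite addrCA subrr addr0.
  rewrite !powRM ?mulr_ge0 ?J// le_eqVlt; apply/orP; left; apply/eqP.
  have -> : - (2 * k%:R - w) = w + (- (2 * k)%:R) by rewrite natrM; ring.
  rewrite [powR (jbr R xi) (mu + w)]powRD ?(gt_eqF (jbr_gt0 _)) ?implybT//.
  rewrite [powR (jbr R (eta - xi)) (w + _)]powRD ?(gt_eqF (jbr_gt0 _)) ?implybT//.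
  by ring.
rewrite -mulr_sumr -[powR 2 w * C * M * _]mulrAC ler_wpM2l ?mulr_ge0 ?powR_ge0//.
(* Translation by [xi] is injective on the lattice, so the remaining sum has the bound [M] uniformly
   in [xi]. *)
have := HM [seq eta - xi | eta <- F]; rewrite big_map; apply.
by rewrite map_inj_uniq//; exact: addIr.
Qed.

End Symbol.

End SymbolEstimates.

(** * Limits with explicit error bounds *)

Section UniformLimits.
Context {R : realType}.

Lemma tail_small_cvgn (u : nat -> R) :
  (forall e, 0 < e -> exists N0, forall N, (N0 <= N)%N -> `|u N - u N0| <= e) ->
  cvgn u.
Proof.
move=> H; apply: cauchy_cvg; apply: cauchy_exP => e e0.
have [N0 HN] := H (e / 2) (divr_gt0 e0 (ltr0n _ 2)).
exists (u N0); exists N0 => //= N /= /HN h.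
by rewrite /ball/= distrC; apply: le_lt_trans h _; lra.
Qed.

Lemma limn_dist_le (u : nat -> R) (N0 : nat) (e : R) : 0 < e -> cvgn u ->
  (forall N, (N0 <= N)%N -> `|u N - u N0| <= e) -> `|limn u - u N0| <= e.
Proof.
move=> e0 cu H; apply/ler_addgt0Pr => d d0.
move/(@cvgrPdist_lt _ _ _ _ _): (cu) => /(_ d d0)[N1 _ HN].
have h1 := HN (maxn N0 N1) (leq_maxr _ _).
have h2 := H (maxn N0 N1) (leq_maxl _ _).
rewrite -(subrKA (u (maxn N0 N1))) (le_trans (ler_normD _ _))// addrC lerD//.
exact: ltW.
Qed.

Lemma uniform_limit_continuous {n : nat} (f : 'rV[R]_n -> R) :
  (forall e, 0 < e -> exists2 g : 'rV[R]_n -> R, continuous g &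
     forall x, `|f x - g x| <= e) -> continuous f.
Proof.
move=> H x; apply/(@cvgrPdist_le _ _ _ (nbhs x) (nbhs_filter x)) => e e0.
have [g cg fg] := H (e / 3) (divr_gt0 e0 (ltr0n _ 3)).
have /(@cvgrPdist_le _ _ _ (nbhs x) (nbhs_filter x)) := cg x.
move=> /(_ (e / 3) (divr_gt0 e0 (ltr0n _ 3))); apply: filterS => y gy.
have := fg x; have := fg y; move: gy; rewrite !ler_norml; lra.
Qed.

End UniformLimits.

(** * Convergence of the expansion of the operator *)

Section NuclearExpansion.
Context {R : realType} {n : nat}.
Implicit Types (x : 'rV[R]_n) (xi eta : 'rV[int]_n).

Section Series.
Variables (a : 'rV[R]_n -> 'rV[int]_n -> Cplx R) (c : 'rV[int]_n -> Cplx R).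
Variable u : 'rV[int]_n -> R.
Variable M : R.
Hypothesis ca : forall xi, ccontinuous (a^~ xi).
Hypothesis acu : forall x xi, cabs (a x xi * c xi) <= u xi.
Hypothesis uM : sum_bounded u M.

Let y xi := fourier (fun x => e2pi (dotp x xi) * a x xi).

Lemma Ta_partialE N x : Ta_partial a c N x =
  \sum_(xi <- box N) e2pi (dotp x xi) * a x xi * c xi.
Proof. exact: (sum_box _ xpredT (fun xi => e2pi (dotp x xi) * a x xi * c xi)). Qed.

Lemma box_subset N N' : (N <= N')%N -> {subset box (n := n) N <= box N'}.
Proof.
move=> NN xi; rewrite !mem_box => /forallP H; apply/forallP => i.
exact: leq_trans (H i) NN.
Qed.

Lemma exists_box (F : seq 'rV[int]_n) : exists N, {subset F <= box N}.
Proof.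
elim: F => [|xi F [N FN]]; first by exists 0%N.
exists (maxn N (\max_i absz (xi 0%R i))) => eta; rewrite inE => /orP[/eqP ->|/FN].
  rewrite mem_box; apply/forallP => i; rewrite leq_max.
  by apply/orP; right; exact: (@leq_bigmax _ (fun i => absz (xi 0%R i))).
exact/box_subset/leq_maxl.
Qed.

Lemma sum_box_diff (V : zmodType) (F : seq 'rV[int]_n) (v : 'rV[int]_n -> V) N :
  uniq F -> {subset F <= box N} ->
  \sum_(xi <- box N) v xi - \sum_(xi <- F) v xi =
  \sum_(xi <- [seq xi <- box N | xi \notin F]) v xi.
Proof.
move=> uF FN; rewrite (bigID (fun xi => xi \in F))/= big_filter.
rewrite -[X in X + _ - _]big_filter.
rewrite (perm_big F); first by rewrite addrAC subrr add0r.
apply: uniq_perm; rewrite ?filter_uniq ?box_uniq// => xi.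
by rewrite mem_filter; case: (boolP (xi \in F)) => //= /FN.
Qed.

Lemma sum_box_diff_le (F : seq 'rV[int]_n) (e : R) N (b : 'rV[int]_n -> R) :
  (forall G, uniq G -> (forall xi, xi \in G -> xi \notin F) ->
     \sum_(xi <- G) b xi <= e) ->
  \sum_(xi <- [seq xi <- box N | xi \notin F]) b xi <= e.
Proof.
apply; first by rewrite filter_uniq// box_uniq.
by move=> xi; rewrite mem_filter => /andP[].
Qed.

(** The Weierstrass test: [N0] depends on the majorant [u] alone, not on [x]. This uniformity makes
    [Ta_fun] continuous and lets its Fourier coefficients be taken termwise. *)
Lemma Ta_partial_cauchy (e : R) : 0 < e -> exists N0, forall N, (N0 <= N)%N ->
  forall x, cabs (Ta_partial a c N x - Ta_partial a c N0 x) <= e.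
Proof.
move=> e0; have [F0 uF0 tl] := sum_bounded_tail uM e0.
have [N0 FN0] := exists_box F0; exists N0 => N NN x.
rewrite !Ta_partialE sum_box_diff ?box_uniq//; last exact: box_subset.
apply: le_trans (cabs_sum _ _ _) _.
apply: (@le_trans _ _ (\sum_(xi <- [seq xi <- box N | xi \notin box N0]) u xi)).
  by apply: ler_sum => xi _; rewrite -mulrA cabsM cabs_e2pi mul1r.
apply: sum_box_diff_le => G uG GN; apply: tl => // xi /GN.
by apply: contraNN => /FN0.
Qed.

Lemma Ta_fun_approx (e : R) : 0 < e -> exists N0, forall N, (N0 <= N)%N ->
  forall x, cabs (Ta_fun a c x - Ta_partial a c N x) <= e.
Proof.
move=> e0; have [N0 H0] := Ta_partial_cauchy (divr_gt0 e0 (ltr0n R 4)).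
(* [p] stands for the real or the imaginary part, whose limits are taken separately. Each
   contributes [e / 4] and the passage from [N0] to [N] another [e / 4]. *)
have Hp (p : Cplx R -> R) : (forall z w, p (z - w) = p z - p w) ->
    (forall z, `|p z| <= cabs z) -> forall x,
    `|limn (fun N => p (Ta_partial a c N x)) - p (Ta_partial a c N0 x)| <= e / 4.
  move=> pB pc x; apply: limn_dist_le; first by rewrite divr_gt0.
    apply: tail_small_cvgn => d /Ta_partial_cauchy[N1 H1]; exists N1 => N /H1 h.
    by rewrite -pB; apply: le_trans (pc _) (h x).
  by move=> N /H0 h; rewrite -pB; apply: le_trans (pc _) (h x).
exists N0 => N NN x.
rewrite -(subrKA (Ta_partial a c N0 x)) (le_trans (cabsD _ _))//.
have -> : e = (e / 4 + e / 4) + e / 4 + e / 4 by field.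
rewrite -addrA lerD//; last first.
  rewrite -opprB cabsN (le_trans (H0 _ NN x))// lerDl ltW// divr_gt0//.
rewrite (le_trans (cabs_le_ReIm _))// cReD cImD cReN cImN lerD//.
  by apply: (Hp (@cRe R) _ (@cRe_le R) x) => z w; rewrite cReD cReN.
by apply: (Hp (@cIm R) _ (@cIm_le R) x) => z w; rewrite cImD cImN.
Qed.

Lemma ccontinuous_term xi : ccontinuous (fun x => e2pi (dotp x xi) * a x xi).
Proof. by apply: ccontinuousM; [exact: ccontinuous_e2pi|exact: ca]. Qed.

Lemma Ta_partialC N : Ta_partial a c N =
  fun x => \sum_(xi <- box N) c xi * (e2pi (dotp x xi) * a x xi).
Proof.
by apply/funext => x; rewrite Ta_partialE; apply: eq_bigr => xi _; rewrite mulrC.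
Qed.

Lemma ccontinuous_Ta_partial N : ccontinuous (Ta_partial a c N).
Proof.
rewrite Ta_partialC; apply: ccontinuous_sum => xi; apply: ccontinuousM.
  exact: ccontinuous_cst.
exact: ccontinuous_term.
Qed.

Lemma fourier_Ta_partial N eta :
  fourier (Ta_partial a c N) eta = \sum_(xi <- box N) c xi * y xi eta.
Proof.
rewrite Ta_partialC fourier_sum.
  by apply: eq_bigr => xi _; rewrite fourierZ//; exact: ccontinuous_term.
by move=> xi; apply: ccontinuousM; [exact: ccontinuous_cst|exact: ccontinuous_term].
Qed.

Lemma ccontinuous_Ta_fun : ccontinuous (Ta_fun a c).
Proof.
by split; apply: uniform_limit_continuous => e /Ta_fun_approx[N HN];
  have [c1 c2] := ccontinuous_Ta_partial N;
  [exists (fun x => cRe (Ta_partial a c N x)) => // x|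
   exists (fun x => cIm (Ta_partial a c N x)) => // x];
  apply: le_trans (HN N (leqnn _) x);
  [rewrite -cReN -cReD; exact: cRe_le|rewrite -cImN -cImD; exact: cIm_le].
Qed.

Lemma Ta_approx (e : R) : 0 < e -> exists N0, forall N, (N0 <= N)%N ->
  forall eta, cabs (Ta a c eta - \sum_(xi <- box N) c xi * y xi eta) <= e.
Proof.
move=> e0; have [N0 HN] := Ta_fun_approx (divr_gt0 e0 (ltr0n R 2)).
exists N0 => N /HN h eta; rewrite -fourier_Ta_partial /Ta -fourierB.
- have := @cabs_fourier_le _ _ _ eta (e / 2) _ h; rewrite mulrC divfK//; apply.
  apply: ccontinuousD; first exact: ccontinuous_Ta_fun.
  exact/ccontinuousN/ccontinuous_Ta_partial.
- exact: ccontinuous_Ta_fun.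
- exact: ccontinuous_Ta_partial.
Qed.

(** A Fatou-type argument. [Ta_approx] is uniform in [eta] but carries no weight, so a finite set
    [E] is fixed first and the accuracy adapted to its total weight [W]. The box minus [F] is then a
    finite sum, controlled by [b] after exchanging the two sums; finally [d] tends to [0]. *)
Lemma Ta_weighted_tail (w : R) (b : 'rV[int]_n -> R) (F : seq 'rV[int]_n) (e : R) :
  uniq F ->
  (forall xi, sum_bounded
     (fun eta => powR (jbr R eta) w * cabs (c xi * y xi eta)) (b xi)) ->
  (forall G, uniq G -> (forall xi, xi \in G -> xi \notin F) ->
     \sum_(xi <- G) b xi <= e) ->
  sum_bounded (fun eta => powR (jbr R eta) w *
    cabs (Ta a c eta - \sum_(xi <- F) c xi * y xi eta)) e.
Proof.
move=> uF yb tl E uE; apply/ler_addgt0Pr => d d0.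
pose W := \sum_(eta <- E) powR (jbr R eta) w.
have W0 : 0 <= W by apply: sumr_ge0 => eta _; exact: powR_ge0.
(* The [+ 1] keeps the denominator positive when [E] is empty. *)
have d'0 : 0 < d / (W + 1) by rewrite divr_gt0// ltr_wpDl.
have [N1 H1] := Ta_approx d'0; have [N2 FN2] := exists_box F.
pose N := maxn N1 N2; pose G := [seq xi <- box N | xi \notin F].
have FN : {subset F <= box N} by move=> xi /FN2; apply/box_subset/leq_maxr.
apply: (@le_trans _ _ (\sum_(eta <- E) (powR (jbr R eta) w * (d / (W + 1)) +
    \sum_(xi <- G) powR (jbr R eta) w * cabs (c xi * y xi eta)))).
  apply: ler_sum => eta _; rewrite -mulr_sumr -mulrDr ler_wpM2l ?powR_ge0//.
  rewrite -(subrKA (\sum_(xi <- box N) c xi * y xi eta)).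
  apply: le_trans (cabsD _ _) _; rewrite lerD ?H1 ?leq_maxl//.
  by rewrite sum_box_diff// cabs_sum.
rewrite big_split/= -mulr_suml exchange_big/= addrC lerD//.
  apply: (@le_trans _ _ (\sum_(xi <- G) b xi)); last exact: sum_box_diff_le.
  by apply: ler_sum => xi _; exact: yb.
by rewrite mulrA ler_pdivrMr ?ltr_wpDl// mulrC ler_wpM2l ?ltW// ltrDl.
Qed.

End Series.

End NuclearExpansion.

(** * Coefficient functionals on the source space *)

Section DualElements.
Context {R : realType} {n : nat}.
Implicit Types (c : 'rV[int]_n -> Cplx R) (o : option 'rV[int]_n).

(** The option is a value of [pickle_inv]: a natural number that codes no lattice point yields
    [None], hence the zero functional. *)
Lemma coefficient_is_dual (w p q : R) o : 0 <= w -> 1 <= p -> 0 < q ->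
  is_dual_elt w p%:E q%:E (fun c => oapp c 0 o).
Proof.
move=> w0 p1 q0; split; first by move=> c d l _ _; case: o => //=; rewrite mulr0 addr0.
exists 4 => c _; case: o => [xi|]; first exact: cabs_le_besov_norm.
by rewrite [oapp _ _ _]/= cabs0 mule_ge0 ?lee_fin// besov_norm_ge0.
Qed.

Lemma coefficient_dual_norm_le (w p q : R) o : 0 <= w -> 1 <= p -> 0 < q ->
  (dual_norm w p%:E q%:E (fun c : 'rV[int]_n -> Cplx R => oapp c 0%R o) <= 4%:E)%E.
Proof.
move=> w0 p1 q0; apply: ub_ereal_sup => _ [c [_ c1] <-].
case: o => [xi|] /=; last by rewrite cabs0 lee_fin.
apply: le_trans (cabs_le_besov_norm c xi w0 p1 q0) _.
by rewrite -[leRHS]mule1 lee_wpmul2l ?lee_fin.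
Qed.

(** The unit ball contains the zero sequence, so the supremum is not over the empty set, where it
    would be [-oo]. Nonnegativity is what monotonicity of products and powers requires. *)
Lemma dual_norm_ge0 (w : R) (p q : \bar R)
    (e : ('rV[int]_n -> Cplx R) -> Cplx R) :
  0 <= w -> (1%:E <= p)%E -> (1%:E <= q)%E -> (0 <= dual_norm w p q e)%E.
Proof.
move=> w0 p1 q1; pose z (_ : 'rV[int]_n) : Cplx R := 0.
have z0 : (besov_norm w p q z <= 0%:E)%E.
  apply: besov_norm_le => // F _.
  by rewrite big1// => xi _; rewrite cabs0 mulr0.
apply: (@le_trans _ _ (cabs (e z))%:E); first by rewrite lee_fin cabs_ge0.
apply: ereal_sup_ubound; exists z => //; split.
  by apply: le_lt_trans z0 _; rewrite ltry.
by apply: le_trans z0 _; rewrite lee_fin.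
Qed.

End DualElements.

(** * The nuclear representation and its convergence *)

Theorem theorem3p3 (R : realType) (n : nat) (r alpha rho delta m : R)
    (k : nat) (a : 'rV[R]_n -> 'rV[int]_n -> Cplx R)
    (w1 p1 q1 w2 : R) (p2 q2 : \bar R) :
  0 < r <= 1 -> 0 < alpha <= 1 / 2 -> 0 <= rho <= 1 -> 0 <= delta <= 1 ->
  (n%:R / 2 : R) < k%:R ->
  symbol_class m rho delta (2 * k) a ->
  w1 = alpha * n%:R ->
  1 < p1 <= 2 ->
  q1 = (alpha + (1 - p1^-1))^-1 ->
  0 <= w2 < 2 * k%:R - n%:R ->
  m < - (n%:R / r) - w2 - 2 * k%:R * delta ->
  ((1:R)%:E <= p2)%E -> ((1:R)%:E <= q2)%E ->
  r_nuclear r (Ta a) w1 p1%:E q1%:E w2 p2 q2.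
Proof.
move=> /andP[r0 r1] /andP[alpha0 alpha1] _ /andP[delta0 _] _ sa w1E.
move=> /andP[p1gt1 p1le2] q1E w2k mlt p2ge1 q2ge1.
have w20 : 0 <= w2 by case/andP: w2k.
have w10 : 0 <= w1 by rewrite w1E mulr_ge0 ?(ltW alpha0).
have p1ge1 : 1 <= p1 by exact: ltW.
(* [1 / q1 = alpha + 1 - 1 / p1 <= 1/2 + 1/2], from [alpha <= 1/2] and [p1 <= 2]. *)
have q1ge1 : 1 <= q1.
  have p1V : 2^-1 <= p1^-1 < 1.
    by rewrite lef_pV2 ?posrE ?invf_lt1 ?(lt_trans ltr01 p1gt1)// p1le2.
  by rewrite q1E invf_ge1; lra.
have q10 : 0 < q1 by exact: lt_le_trans q1ge1.
pose s := - (m + 2 * k%:R * delta + w2).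
have nrs : n%:R / r < s by rewrite /s; lra.
(* As [r <= 1], [n <= n / r]. This gives absolute convergence of the operator series, whereas
   [s r > n] serves the nuclear sum. *)
have ns : n%:R < s.
  apply: le_lt_trans nrs; rewrite ler_pdivlMr//.
  by rewrite ler_piMr.
have nsr : n%:R < s * r by rewrite -ltr_pdivrMr.
have [K K0 HK] := symbol_weighted_sum_le delta0 sa w2k.
have [C C0 HC] := symbol_le sa.
have [M HM] := jbr_sum_bounded (R := R) ns.
have [M' HM'] := jbr_sum_bounded (R := R) nsr.
pose y xi := fourier (fun x => e2pi (dotp x xi) * a x xi).
(* With [pickle_inv] each lattice point is met at exactly one index; all other indices contribute
   zero terms. *)
pose e (j : nat) (c : 'rV[int]_n -> Cplx R) : Cplx R := oapp c 0 (pickle_inv j).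
pose v (j : nat) (eta : 'rV[int]_n) : Cplx R := oapp (y^~ eta) 0 (pickle_inv j).
pose b (o : option 'rV[int]_n) := oapp (fun xi => powR (jbr R xi) (- s)) 0 o.
have b0 o : 0 <= b o by case: o => //= xi; exact: powR_ge0.
have HKs xi : sum_bounded (fun eta => powR (jbr R eta) w2 * cabs (y xi eta))
    (K * powR (jbr R xi) (- s)).
  by rewrite /s opprK; exact: HK.
have v_le j : (besov_norm w2 p2 q2 (v j) <= (K * b (pickle_inv j))%:E)%E.
  apply: besov_norm_le => // F uF; rewrite /v /b.
  case: (pickle_inv j) => [xi|] /=; first exact: HKs.
  by rewrite mulr0 big1// => eta _; rewrite cabs0 mulr0.
exists e, v; split; first by move=> j; exact: coefficient_is_dual.
split; first by move=> j; apply: le_lt_trans (v_le j) _; rewrite ltry.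
(* The lattice points coded below [N]: the first [N] terms as a sum over a finite set. *)
pose S N := pmap (@pickle_inv 'rV[int]_n) (iota 0 N).
have uS N : uniq (S N).
  by apply: (pmap_uniq (@pickle_invK _)); exact: iota_uniq.
split.
  apply: (@le_lt_trans _ _ (powR (4 * K) r * M')%:E); last by rewrite ltry.
  apply: lime_le; first by apply: is_cvg_nneseries => j _ _; exact: poweR_ge0.
  apply: nearW => N.
  apply: (@le_trans _ _ (\sum_(0 <= j < N)
      (powR (4 * K) r * powR (b (pickle_inv j)) r)%:E)%E).
    apply: lee_sum => j _.
    have d0 : (0 <= dual_norm w1 p1%:E q1%:E (e j))%E.
      by apply: dual_norm_ge0; rewrite ?lee_fin.
    rewrite -powRM ?mulr_ge0// -poweR_EFin; apply: gt0_ler_poweR.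
    - exact: ltW.
    - by apply: in_itv0y; rewrite mule_ge0// besov_norm_ge0.
    - by apply: in_itv0y; rewrite lee_fin !mulr_ge0.
    - rewrite -mulrA EFinM; apply: lee_pmul => //; first exact: besov_norm_ge0.
      exact: coefficient_dual_norm_le.
  rewrite sumEFin lee_fin -mulr_sumr ler_wpM2l ?powR_ge0//.
  apply: le_trans (HM' (S N) (uS N)); rewrite /S big_pmap /index_iota subn0.
  apply: ler_sum => j _; rewrite /b; case: (pickle_inv j) => [xi|] /=.
    by rewrite -powRrM mulNr.
  by rewrite powR0 ?gt_eqF.
(* Of [c] only this uniform bound on its coefficients enters the convergence argument. *)
move=> c Hc; pose L := fine (4%:E * besov_norm w1 p1%:E q1%:E c)%E.
have cL xi : cabs (c xi) <= L.
  rewrite -lee_fin fineK; first exact: cabs_le_besov_norm.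
  by rewrite fin_numM// ge0_fin_numE ?besov_norm_ge0.
have L0 : 0 <= L by apply: le_trans (cL 0); exact: cabs_ge0.
pose g N := besov_norm w2 p2 q2
  (fun xi => Ta a c xi - \sum_(j < N) e j c * v j xi).
have gS N eta : \sum_(j < N) e j c * v j eta = \sum_(xi <- S N) c xi * y xi eta.
  rewrite -(big_mkord xpredT (fun j => e j c * v j eta)) /S big_pmap /index_iota subn0.
  by apply: eq_bigr => j _; rewrite /e /v; case: (pickle_inv j) => //=; rewrite mul0r.
have acu x xi : cabs (a x xi * c xi) <= C * L * powR (jbr R xi) (- s).
  rewrite cabsM mulrAC ler_pM ?cabs_ge0//.
  (* [m <= m + 2k delta + w2 = - s], so the symbol itself is also bounded by a multiple of
     [<xi>^(-s)]. *)
  apply: le_trans (HC x xi) _; rewrite ler_wpM2l// ler_powR ?jbr_ge1//.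
  by rewrite /s opprK -addrA lerDl addr_ge0// !mulr_ge0.
have uM : sum_bounded (fun xi : 'rV[int]_n => C * L * powR (jbr R xi) (- s)) (C * L * M).
  move=> F uF; rewrite -mulr_sumr.
  exact: (ler_wpM2l (mulr_ge0 C0 L0) (HM F uF)).
have yb xi : sum_bounded (fun eta => powR (jbr R eta) w2 * cabs (c xi * y xi eta))
    (L * K * powR (jbr R xi) (- s)).
  move=> F uF; apply: (@le_trans _ _ (L *
    \sum_(eta <- F) powR (jbr R eta) w2 * cabs (y xi eta))).
    rewrite mulr_sumr; apply: ler_sum => eta _.
    by rewrite cabsM mulrCA ler_wpM2r ?mulr_ge0 ?powR_ge0 ?cabs_ge0.
  by rewrite -mulrA; apply: ler_wpM2l => //; exact: HKs.
have bM : sum_bounded (fun xi : 'rV[int]_n => L * K * powR (jbr R xi) (- s)) (L * K * M).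
  move=> F uF; rewrite -mulr_sumr.
  exact: (ler_wpM2l (mulr_ge0 L0 K0) (HM F uF)).
have small d : 0 < d -> exists N0, forall N, (N0 <= N)%N -> (g N <= d%:E)%E.
  move=> d0; have [F0 uF0 tl] := sum_bounded_tail bM d0.
  (* Beyond this index [S N] contains [F0], so what is left out lies in the small tail. *)
  exists (\max_(xi <- F0) (pickle xi).+1)%N => N NN; apply: besov_norm_le => //.
  under eq_fun do rewrite gS.
  apply: (Ta_weighted_tail (ccontinuous_symbol sa) acu uM (uS N) yb) => G uG GS.
  apply: tl => // xi /GS; apply: contraNN => xiF.
  rewrite mem_pmap; apply/mapP; exists (pickle xi); last by rewrite pickleK_inv.
  rewrite mem_iota add0n; apply: leq_trans NN.
  exact: (@leq_bigmax_seq _ F0 xpredT (fun xi => (pickle xi).+1) xi xiF isT).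
apply/fine_cvgP; split.
  have [N0 HN] := small 1 ltr01; exists N0 => // N /= /HN gN.
  by rewrite ge0_fin_numE ?besov_norm_ge0//; apply: le_lt_trans gN _; rewrite ltry.
apply/cvgrPdist_le => d d0; have [N0 HN] := small d d0; exists N0 => // N /= /HN gN.
have gf : g N \is a fin_num.
  by rewrite ge0_fin_numE ?besov_norm_ge0//; apply: le_lt_trans gN _; rewrite ltry.
rewrite sub0r normrN ger0_norm ?fine_ge0 ?besov_norm_ge0//.
by rewrite -lee_fin fineK.
Qed.
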